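(* There exists a Gurariĭ space $E$ of density $\aleph_1$ that has a projectional resolution of the identity.
   Context: All Banach spaces are real. The density of a Banach space is the least cardinality of a dense subset. For $\varepsilon>0$, a linear operator $f\colon X\to Y$ between Banach spaces is an $\varepsilon$-isometric embedding if $(1+\varepsilon)^{-1}\|x\|\leq\|f(x)\|\leq(1+\varepsilon)\|x\|$ for every $x\in X\setminus\{0\}$; isometric embeddings are always linear. A Banach space $X$ is Gurariĭ if for every pair of finite-dimensional Banach spaces $S\subseteq T$, every isometric embedding $f\colon S\to X$ and every $\varepsilon>0$, there exists an $\varepsilon$-isometric embedding $g\colon T\to X$ with $g\restriction S=f$. A projectional resolution of the identity in a Banach space $E$ of density $\aleph_1$ is a transfinite sequence $\{P_\alpha\}_{\alpha<\omega_1}$ of norm one linear projections of $E$ whose images are separable and form a continuous chain covering $E$ (that is, $P_\alpha E\subseteq P_\beta E$ for $\alpha<\beta$, $P_\delta E=\operatorname{cl}(\bigcup_{\xi<\delta}P_\xi E)$ for every limit ordinal $\delta<\omega_1$, and $\bigcup_{\alpha<\omega_1}P_\alpha E=E$), and such that $P_\alpha P_\beta=P_{\min\{\alpha,\beta\}}$ for all $\alpha,\beta<\omega_1$. *)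

(* Defs.v *)
From HB Require Import structures.
From mathcomp Require Import all_boot all_order all_algebra.
From mathcomp Require Import all_classical all_reals all_analysis.
From mathcomp Require wochoice.
Set Implicit Arguments.
Unset Strict Implicit.
Unset Printing Implicit Defensive.
Import Order.TTheory GRing.Theory Num.Theory.
Import numFieldNormedType.Exports.
Local Open Scope classical_set_scope.
Local Open Scope card_scope.
Local Open Scope ring_scope.

Definition wo_le : rel (set nat) :=
  sval (wochoice.well_ordering_principle (set nat)).

(* [omega1] is the set of ordinals < ω₁, realized as the initial segment of a
   fixed well-ordering of [set nat] formed by the points having only countably
   many predecessors. The lemmas [omega1_min], [omega1_countable_seg] and
   [omega1_uncountable] below characterize it up to order isomorphism. *)
Record omega1 : Type := Omega1 {
  omega1_val : set nat;
  omega1_valP : `[< countable [set z | wo_le z omega1_val] >] }.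

HB.instance Definition _ := [isSub for omega1_val].
HB.instance Definition _ := [Choice of omega1 by <:].

Lemma wo_leP : wochoice.well_order wo_le.
Proof. exact: svalP (wochoice.well_ordering_principle (set nat)). Qed.

Lemma wo_le_chain : wochoice.wo_chain wo_le predT.
Proof. by move=> A _; exact: wo_leP. Qed.

Lemma wo_le_anti : antisymmetric wo_le.
Proof. by move=> x y; apply: (wochoice.wo_chain_antisymmetric wo_le_chain). Qed.

Lemma wo_le_total : total wo_le.
Proof. by move=> x y; apply: (wochoice.wo_chainW wo_le_chain). Qed.

Lemma wo_le_min (A : set (set nat)) : A !=set0 ->
  exists2 x, A x & forall y, A y -> wo_le x y.
Proof.
move=> [x Ax]; have [|z [[zA zle] _]] := wo_leP (A := mem A).
  by exists x; exact/mem_set.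
exists z; first exact/set_mem.
by move=> y Ay; apply: zle; exact/mem_set.
Qed.

Lemma wo_le_trans : transitive wo_le.
Proof.
move=> y x z xy yz.
have [|m [->|[->|->]] mle] := @wo_le_min [set t | t = x \/ t = y \/ t = z].
- by exists x; left.
- by apply: mle; right; right.
- by have -> // : x = y by apply: wo_le_anti; rewrite xy mle//; left.
- by have <- // : y = z by apply: wo_le_anti; rewrite yz mle//; right; left.
Qed.

Definition omega1_le : rel omega1 := fun a b => wo_le (val a) (val b).

Lemma omega1_le_refl : reflexive omega1_le.
Proof. by move=> x; apply: (wochoice.wo_chain_reflexive wo_le_chain). Qed.

Lemma omega1_le_anti : antisymmetric omega1_le.
Proof. by move=> x y /wo_le_anti/val_inj. Qed.

Lemma omega1_le_trans : transitive omega1_le.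
Proof. by move=> y x z; exact: wo_le_trans. Qed.

Lemma omega1_le_total : total omega1_le.
Proof. by move=> x y; exact: wo_le_total. Qed.

HB.instance Definition _ := Order.Le_isPOrder.Build Order.default_display omega1
  omega1_le_refl omega1_le_anti omega1_le_trans.
HB.instance Definition _ :=
  Order.POrder_isTotal.Build Order.default_display omega1 omega1_le_total.

Lemma omega1_min (A : set omega1) : A !=set0 ->
  exists2 a, A a & forall b, A b -> (a <= b)%O.
Proof.
move=> [a0 Aa0]; have [|_ [a Aa <-] amin] := @wo_le_min (val @` A).
  by exists (val a0); exists a0.
by exists a => // b Ab; apply: amin; exists b.
Qed.

Lemma omega1_countable_seg (a : omega1) : countable [set b | (b <= a)%O].
Proof.
have /countable_injP[f finj] := asboolW (omega1_valP a).
apply/countable_injP; exists (f \o val) => x y /set_mem xa /set_mem ya fxy.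
by apply/val_inj/finj => //; exact/mem_set.
Qed.

Lemma omega1_uncountable : ~ countable [set: omega1].
Proof.
move=> cW.
pose C := [set y : set nat | countable [set z | wo_le z y]].
have cC : countable C.
  have -> : C = val @` [set: omega1].
    apply/seteqP; split => [y /asboolT Cy|_ [b _ <-]].
      by exists (Omega1 Cy).
    exact: asboolW (omega1_valP b).
  exact: sub_countable (card_image_le _ _) cW.
have [CT|] := pselect (forall x, C x).
  move: cC => /countable_injP[f finj].
  pose D := [set n | exists A, f A = n /\ ~ A n].
  have nD : ~ D (f D).
    move=> /[dup] DfD [A [fA nA]]; apply: nA.
    have -> // : A = D by apply: finj; rewrite ?fA//; apply/mem_set/CT.
  by apply: (nD); exists D.
move=> /existsNP[x0 nCx0].
have [|x nCx xmin] := @wo_le_min (~` C); first by exists x0.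
apply: nCx; apply: (@sub_countable _ _ _ (x |` C)).
  apply: subset_card_le => z /= zx.
  have [Cz|nCz] := pselect (C z); [by right|left].
  by apply: wo_le_anti; rewrite zx xmin.
by rewrite -bigcup2E; apply: bigcup_countable => // -[|[|n]] _ /=.
Qed.

Definition limit_ordinal (d : omega1) : Prop :=
  (exists a, (a < d)%O) /\
  forall a, (a < d)%O -> exists b, (a < b)%O && (b < d)%O.

(* The least cardinality of a dense subset of [X] is the cardinality of [K]. *)
Definition density_eq (X : topologicalType) (U : Type) (K : set U) : Prop :=
  (exists2 D : set X, dense D & D #= K) /\
  (forall D : set X, dense D -> K #<= D).

Definition separable_set (X : topologicalType) (A : set X) : Prop :=
  exists C : set X, [/\ countable C, C `<=` A & A `<=` closure C].

Section banach.
Variable R : realType.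

Definition finite_dimensional (V : lmodType R) : Prop :=
  exists (n : nat) (b : 'I_n -> V),
    forall x, exists c : 'I_n -> R, x = \sum_(i < n) c i *: b i.

Definition eps_isometric_embedding (e : R) (V W : normedModType R)
    (f : {linear V -> W}) : Prop :=
  forall x, x != 0 -> (1 + e)^-1 * `|x| <= `|f x| <= (1 + e) * `|x|.

(* [S] ranges over the linear subspaces of [T]: [val] is the inclusion of [S]
   in [T], and the norm of [S] is the restriction of the norm of [T]. As [T] is
   finite-dimensional, [S] is too, and hence it is complete. *)
Definition gurarii (X : completeNormedModType R) : Prop :=
  forall (T : completeNormedModType R) (P : {pred T}) (S : subLmodType P)
    (f : {linear S -> X}) (e : R),
    finite_dimensional T -> (forall x : S, `|f x| = `|val x|) -> 0 < e ->
    exists g : {linear T -> X},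
      eps_isometric_embedding e g /\ forall x : S, g (val x) = f x.

Definition operator_norm (V W : normedModType R) (f : {linear V -> W}) : \bar R :=
  ereal_sup [set `|f x|%:E | x in [set x : V | `|x| <= 1]].

Record projectional_resolution (E : completeNormedModType R)
    (P : omega1 -> {linear E -> E}) : Prop := {
  pri_proj : forall a x, P a (P a x) = P a x;
  pri_norm : forall a, operator_norm (P a) = 1%E;
  pri_separable : forall a, separable_set (range (P a));
  pri_chain : forall a b, (a < b)%O -> range (P a) `<=` range (P b);
  pri_continuous : forall d, limit_ordinal d ->
    range (P d) = closure (\bigcup_(a in [set a | (a < d)%O]) range (P a));
  pri_cover : \bigcup_(a in [set: omega1]) range (P a) = [set: E];
  pri_comp : forall a b x, P a (P b x) = P (Order.min a b) x }.

End banach.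

(* Main.v *)
Require Import Defs.
From HB Require Import structures.
From mathcomp Require Import all_boot all_order all_algebra.
From mathcomp Require Import all_classical all_reals all_analysis.
From mathcomp Require Import ring lra.

(** The space is freely generated, and the construction is a functor of a set
[I] of base generators, so that self-maps of [I] induce the projections.

Generators. The generators of level 0 are the elements of [I]. Level [n + 1]
adds, for every finite list of pairs [(v_k, r_k)], with [v_k] a rational
combination of generators of level [n] and [r_k] rational, a new generator [e]
asked to satisfy [|e - v_k| <= r_k]. These constraints are imposed only when they
are consistent, [|v_j - v_k| <= r_j + r_k]; each new generator also carries a bound
[B] on its norm, which is imposed in all cases. The space [gen_space R I] is
described by its dual ball: a functional is a family of real values on the
generators obeying the constraints, and the space is the uniform closure of the
rational combinations, seen as functions on the set of these families. Since
intervals of the line that meet pairwise have a common point, functionals extend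
from each level to the next ([dual_ball_extends]): the levels embed isometrically.

Gurarii property. Let a finite-dimensional [S] be embedded in [gen_space R I], let
[t0] be a new vector, and let [s_1, ..., s_m] be a fine net of a large ball of [S]
with images approximated by combinations [v_k]. The list of the [v_k] with radii
slightly above the distances from [t0] to [s_k] is consistent, and its generator
[e] is the image wanted for [t0]. The bounds from above are the constraints. For the
bounds from below, a norming functional of [t0 - s] is transported to the image
of [S], extended by Hahn-Banach ([hahn_banach]), and then given at [e] the value
that it takes at [t0], which the constraints allow ([extension_approx]). Adding in
this way the vectors of a spanning family one by one, with constants that increase
up to [1 + e], gives [gurarii_gen_space].

Projections. A map [f : I -> J] acts on generators. It preserves consistency,
because functionals pull back along it ([dual_ball_map]), so it induces a linear
contraction, functorially. With [I = option omega1], the maps that keep the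
ordinals below [a] and send everything else to [None] induce projections [proj a]
([proj_resolution]); the composition rule is the composition of these maps, and
continuity at limits holds because a combination involves finitely many base
generators. All the data attached to generators is rational, so countably many
base generators span a separable space; hence the projections have separable
range, and the density is at most [aleph_1]. It is not less, because the base
generators are at mutual distance 2 ([base_separated]). *)
Set Implicit Arguments.
Unset Strict Implicit.
Unset Printing Implicit Defensive.
Import Order.TTheory GRing.Theory Num.Theory.
Import numFieldNormedType.Exports.
Local Open Scope classical_set_scope.
Local Open Scope ring_scope.

(** * Linear graphs and the Hahn-Banach theorem *)

Section linear_graph.
Variables (R : realType) (A B : lmodType R).

(** Partially defined linear maps are handled through their graphs: extending
one is then adding a vector to a subspace, with no choice of a complement, and
single-valuedness comes for free from the norm estimates. *)
Definition linear_graph (G : set (A * B)) :=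
  G 0 /\ forall (a : R) x y, G x -> G y -> G (a *: x + y).

Definition adjoin (G : set (A * B)) (p : A * B) : set (A * B) :=
  [set z | exists x a, G x /\ z = x + a *: p].

Lemma linear_graphD G x y : linear_graph G -> G x -> G y -> G (x + y).
Proof. by move=> [_ GL] Gx Gy; rewrite -[x]scale1r; exact: GL. Qed.

Lemma linear_graphZ G a x : linear_graph G -> G x -> G (a *: x).
Proof. by move=> [G0 GL] Gx; rewrite -[_ *: _]addr0; exact: GL. Qed.

Lemma linear_graphB G x y : linear_graph G -> G x -> G y -> G (x - y).
Proof.
move=> lG Gx Gy; apply: linear_graphD => //.
by rewrite -scaleN1r; exact: linear_graphZ.
Qed.

Lemma adjoin_linear G p : linear_graph G -> linear_graph (adjoin G p).
Proof.
move=> lG; split; first by exists 0, 0; rewrite scale0r addr0; split => //; case: lG.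
move=> a _ _ [x [b [Gx ->]]] [y [c [Gy ->]]].
exists (a *: x + y), (a * b + c); split; first by case: lG => _; apply.
by rewrite scalerDr scalerDl scalerA addrACA.
Qed.

Lemma sub_adjoin G p : G `<=` adjoin G p.
Proof. by move=> x Gx; exists x, 0; rewrite scale0r addr0. Qed.

Lemma mem_adjoin G p : linear_graph G -> adjoin G p p.
Proof. by move=> [G0 _]; exists 0, 1; rewrite scale1r add0r. Qed.

(** By homogeneity, a norm estimate on [adjoin G p] has to be checked on [G]
and on the affine subspace [p + G] only. Both the one-dimensional step of
Hahn-Banach and the extension of almost isometries are used through this
reduction. *)
Lemma adjoin_homogeneous G p (Q : A * B -> Prop) : linear_graph G ->
  (forall (a : R) z, Q z -> Q (a *: z)) -> (forall x, G x -> Q x) ->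
  (forall x, G x -> Q (p + x)) -> forall z, adjoin G p z -> Q z.
Proof.
move=> lG QZ QG Qp _ [x [a [Gx ->]]].
have [->|a0] := eqVneq a 0; first by rewrite scale0r addr0; exact: QG.
have -> : x + a *: p = a *: (p + a^-1 *: x).
  by rewrite scalerDr scalerA divff// scale1r addrC.
by apply: QZ; apply: Qp; exact: linear_graphZ.
Qed.

Lemma graph_fun G : linear_graph G -> (forall y, G (0, y) -> y = 0) ->
  (forall x, exists y, G (x, y)) ->
  exists h : {linear A -> B}, forall x y, G (x, y) <-> y = h x.
Proof.
move=> lG G0 /choice[h hP].
have hU x y : G (x, y) -> y = h x.
  move=> Gxy; apply/eqP; rewrite -subr_eq0; apply/eqP/G0.
  by have : G (x - x, y - h x) := linear_graphB lG Gxy (hP x); rewrite subrr.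
have hL : linear h.
  move=> a x y; apply/esym/hU.
  by have [_ /(_ a _ _ (hP x) (hP y))] := lG.
exists (HB.pack_for {linear A -> B} h (GRing.isLinear.Build R A B _ h hL)).
by move=> x y; split => [/hU//|->].
Qed.

End linear_graph.

Section hahn_banach.
Variables (R : realType) (V : normedModType R).

Let dominated (G : set (V * R^o)) := forall z, G z -> `|z.2| <= `|z.1|.

Let dominatedZ (a : R) (z : V * R^o) : `|z.2| <= `|z.1| ->
  `|(a *: z).2| <= `|(a *: z).1|.
Proof. by move=> zz; rewrite /= !normrZ ler_wpM2l. Qed.

(** The admissible values at [v] form an interval, nonempty since [z.2 - w.2
<= |z.1 - w.1| <= |v + z.1| + |v + w.1|]; its lower end is chosen. *)
Lemma dominated_adjoin (G : set (V * R^o)) (v : V) : linear_graph G ->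
  dominated G -> exists r : R^o, dominated (adjoin G (v, r)).
Proof.
move=> lG dG.
pose S := [set - z.2 - `|v + z.1| | z in G].
have S0 : S !=set0 by exists (- 0 - `|v + 0|), 0 => //; case: lG.
have ubS z : G z -> ubound S (- z.2 + `|v + z.1|).
  move=> Gz _ [w Gw <-].
  have /= := dG _ (linear_graphB lG Gz Gw).
  have -> : z.1 - w.1 = (v + z.1) - (v + w.1) by rewrite opprD addrACA subrr add0r.
  move=> /(le_trans (ler_norm _))/le_trans/(_ (ler_normB _ _)); lra.
exists (sup S); apply: (adjoin_homogeneous lG dominatedZ) => // z Gz /=.
have h1 : sup S <= - z.2 + `|v + z.1| by apply: ge_sup => //; exact: ubS.
have h2 : - z.2 - `|v + z.1| <= sup S.
  by apply: ub_le_sup; [exists (- z.2 + `|v + z.1|); exact: ubS|exists z].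
rewrite ler_norml; apply/andP; split; lra.
Qed.

(** A maximal dominated linear graph, given by Zorn's lemma, has full domain
by the one-dimensional step. *)
Theorem hahn_banach (G : set (V * R^o)) : linear_graph G -> dominated G ->
  exists h : {linear V -> R^o},
    (forall v, `|h v| <= `|v|) /\ (forall z, G z -> h z.1 = z.2).
Proof.
move=> lG dG.
pose P (X : set (V * R^o)) :=
  X = set0 \/ [/\ G `<=` X, linear_graph X & dominated X].
have [|X [PX Xmax]] := @Zorn_bigcup _ P.
  move=> F FP Ftot.
  have [|F0] := pselect (exists X, F X /\ X !=set0); last first.
    left; rewrite -subset0 => z [X FX Xz].
    by apply: F0; exists X; split => //; exists z.
  move=> [X0 [FX0 [z0 Xz0]]]; right.
  have good X z : F X -> X z -> [/\ G `<=` X, linear_graph X & dominated X].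
    by move=> FX Xz; have [X00|//] := FP _ FX; move: Xz; rewrite X00.
  have [GX0 [X00 _] _] := good _ _ FX0 Xz0.
  split; first by move=> z /GX0; exists X0.
  - split; first by exists X0.
    move=> a x y [X FX Xx] [Y FY Yy].
    have [XY|YX] := Ftot _ _ FX FY.
      by exists Y => //; have [_ [_ + ] _] := good _ _ FY Yy; apply => //; exact: XY.
    by exists X => //; have [_ [_ + ] _] := good _ _ FX Xx; apply => //; exact: YX.
  - by move=> z [X FX Xz]; have [_ _] := good _ _ FX Xz; exact.
have [GX lX dX] : [/\ G `<=` X, linear_graph X & dominated X].
  have [X0|//] := PX.
  exfalso; apply: (Xmax G); last by right; split.
  rewrite X0; split => //; case: lG => G0 _ /(_ _ G0).
  by [].
have [|v|h hP] := graph_fun lX.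
- by move=> y /dX/=; rewrite normr0 normr_le0 => /eqP.
- have [r dr] := dominated_adjoin v lX dX.
  exists r; apply: contrapT => nXr.
  apply: (Xmax (adjoin X (v, r))).
    split; first exact: sub_adjoin.
    by move=> /(_ _ (mem_adjoin _ lX)).
  right; split => //; last exact: adjoin_linear.
  by apply: subset_trans GX _; exact: sub_adjoin.
- exists h; split => [v|[v r] /GX/hP//].
  by apply: (dX (v, h v)); apply/hP.
Qed.

Lemma norming_functional (v : V) : exists h : {linear V -> R^o},
  (forall w, `|h w| <= `|w|) /\ h v = `|v|.
Proof.
pose O : set (V * R^o) := [set 0].
have lO : linear_graph O by split => // a _ _ -> ->; rewrite scaler0 addr0.
have [||h [hle hv]] := @hahn_banach (adjoin O (v, `|v| : R^o)).
- exact: adjoin_linear.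
- apply: (adjoin_homogeneous lO dominatedZ); first by move=> _ ->; rewrite !normr0.
  by move=> _ ->; rewrite addr0 /= normr_id.
- by exists h; split => //; exact: (hv _ (mem_adjoin _ lO)).
Qed.

End hahn_banach.

(** * Total boundedness in finite-dimensional spaces *)

Section total_boundedness.
Variables (R : realType) (T : normedModType R).

(** Total boundedness of the bounded parts of [V]. *)
Definition finite_nets (V : set T) := forall M del : R, 0 < del ->
  exists l : seq T, forall v, V v -> `|v| <= M -> exists2 x, x \in l & `|v - x| <= del.

Fixpoint span_set (bs : seq T) : set T :=
  if bs is b :: bs' then [set v + a *: b | v in span_set bs' & a in [set: R]]
  else [set 0].

Lemma span_set_linear bs : span_set bs 0 /\
  forall (a : R) x y, span_set bs x -> span_set bs y -> span_set bs (a *: x + y).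
Proof.
elim: bs => [|b bs [IH0 IH]] /=.
  by split => // a _ _ -> ->; rewrite scaler0 addr0.
split; first by exists 0 => //; exists 0 => //; rewrite scale0r addr0.
move=> a _ _ [x Vx [c _ <-]] [y Vy [d _ <-]].
exists (a *: x + y); first exact: IH.
exists (a * c + d) => //.
by rewrite scalerDr scalerDl scalerA addrACA.
Qed.

Lemma mem_span_set (I : Type) (b : I -> T) (c : I -> R) (s : seq I) :
  span_set [seq b i | i <- s] (\sum_(i <- s) c i *: b i).
Proof.
elim: s => [|i s IH] /=; first by rewrite big_nil.
by rewrite big_cons addrC; exists (\sum_(i <- s) c i *: b i) => //; exists (c i).
Qed.

Lemma real_grid (L eta : R) : 0 < eta -> exists s : seq R,
  forall x, `|x| <= L -> exists2 y, y \in s & `|x - y| <= eta.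
Proof.
move=> eta0.
exists [seq k%:R * eta - L | k <- iota 0 (Num.truncn ((L + L) / eta)).+1] => x.
rewrite ler_norml => /andP[Lx xL].
set q := (x + L) / eta.
have q0 : 0 <= q by apply: divr_ge0; [lra|exact: ltW].
have /andP[q1 q2] := truncn_itv q0.
exists ((Num.truncn q)%:R * eta - L).
  apply/mapP; exists (Num.truncn q) => //; rewrite mem_iota add0n /= ltnS.
  by apply: le_truncn; rewrite /q ler_pM2r ?invr_gt0//; lra.
have qx : x + L = q * eta by rewrite /q divfK ?gt_eqF.
have -> : x - ((Num.truncn q)%:R * eta - L) = (q - (Num.truncn q)%:R) * eta.
  by rewrite mulrBl -qx; ring.
rewrite -natr1 in q2.
rewrite normrM (gtr0_norm eta0) ler_piMl ?(ltW eta0)// ler_norml.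
by apply/andP; split; lra.
Qed.

(** If [b] is at positive distance from [V], the coefficient of [b] is bounded
on bounded sets, and a net of [V] combines with a grid of coefficients.
Otherwise [V] is dense in the sum, and a net of a slightly larger ball of [V]
is enough. This avoids choosing a basis or knowing that finite-dimensional
subspaces are closed. *)
Lemma finite_nets_add (V : set T) (b : T) : V 0 ->
  (forall (a : R) x y, V x -> V y -> V (a *: x + y)) -> finite_nets V ->
  finite_nets [set v + a *: b | v in V & a in [set: R]].
Proof.
move=> V0 VL Vnet M del del0.
have VZ (a : R) x : V x -> V (a *: x) by move=> Vx; rewrite -[_ *: _]addr0; exact: VL.
have del20 : 0 < del / 2 by rewrite divr_gt0.
have [[d d0 bd]|nd] := pselect (exists2 d : R, 0 < d &
    forall v a, V v -> d * `|a| <= `|v + a *: b|).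
  have [l lP] := Vnet (M + M / d * `|b|) _ del20.
  have b1 : 0 < `|b| + 1 by rewrite ltr_wpDl.
  have [s sP] := @real_grid (M / d) (del / 2 / (`|b| + 1)) (divr_gt0 del20 b1).
  exists [seq v + a *: b | v <- l, a <- s].
  move=> _ [v Vv [a _ <-]] vM.
  have aM : `|a| <= M / d by rewrite ler_pdivlMr// mulrC (le_trans (bd _ _ Vv)).
  have [|w wl vw] := lP v Vv.
    rewrite -[v](addrK (a *: b)) (le_trans (ler_normB _ _))// lerD// normrZ.
    by rewrite ler_wpM2r.
  have [c cs ac] := sP a aM.
  exists (w + c *: b); first by apply/allpairsP; exists (w, c).
  rewrite opprD addrACA -scalerBl (le_trans (ler_normD _ _))//.
  rewrite [leRHS]splitr lerD// normrZ.
  apply: (@le_trans _ _ (del / 2 / (`|b| + 1) * (`|b| + 1))).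
    by apply: ler_pM => //; rewrite lerDl.
  by rewrite divfK ?gt_eqF.
have [l lP] := Vnet (M + del) _ del20.
exists l => _ [v Vv [a _ <-]] vM.
have [a0|a0] := eqVneq a 0.
  rewrite a0 scale0r addr0 in vM *.
  have [|x xl vx] := lP v Vv; first by rewrite (le_trans vM)// lerDl ltW.
  by exists x => //; rewrite (le_trans vx)//; lra.
(* Now b is a limit of elements of V: v + a b is replaced by a nearby v + a u in V. *)
have [u Vu ub] : exists2 u, V u & `|u - b| <= del / 2 / `|a|.
  apply: contrapT => nu; apply: nd.
  exists (del / 2 / `|a|); first by rewrite divr_gt0 ?normr_gt0.
  move=> w c Vw; have [->|c0] := eqVneq c 0; first by rewrite normr0 mulr0.
  rewrite -ler_pdivlMr ?normr_gt0//.
  apply: contrapT => /negP; rewrite -ltNge => h.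
  apply: nu; exists (- c^-1 *: w); first exact: VZ.
  apply: ltW; apply: le_lt_trans h.
  rewrite -normfV [X in _ <= X]mulrC -normrZ scalerDr scalerA mulVf// scale1r.
  by rewrite scaleNr -opprD normrN.
have Vvu : V (v + a *: u) by rewrite addrC; exact: VL.
have vu : `|v + a *: b - (v + a *: u)| <= del / 2.
  rewrite opprD addrACA subrr add0r -scalerBr normrZ distrC mulrC.
  by rewrite -ler_pdivlMr ?normr_gt0.
have [|x xl vx] := lP _ Vvu.
  rewrite -[X in `|X|](subrK (v + a *: b)) (le_trans (ler_normD _ _))//.
  by rewrite distrC addrC lerD//; lra.
exists x => //.
rewrite -[X in `|X - x|](subrK (v + a *: u)) -addrA (le_trans (ler_normD _ _))//.
lra.
Qed.

Lemma finite_nets_span bs : finite_nets (span_set bs).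
Proof.
elim: bs => [|b bs IH] /=.
  move=> M del del0; exists [:: 0] => _ -> _; exists 0; rewrite ?mem_seq1//.
  by rewrite subrr normr0 ltW.
by have [V0 VL] := span_set_linear bs; exact: finite_nets_add.
Qed.

End total_boundedness.

(** * Generators and the dual ball they define *)

Definition comb (G : Type) : Type := seq (rat * G).
(** One step of the construction: [inr (B, l)] is the new generator with norm
bound [B] and list [l] of pairs (centre, radius). The bound is there because
the constraints in [l] are not imposed when they are inconsistent, and the
generator must still be a bounded function on the dual ball. *)
Definition ext (G : Type) : Type := (G + nat * seq (comb G * rat))%type.
Fixpoint gen (n : nat) (I : Type) : Type := if n is m.+1 then ext (gen m I) else I.

(** The default entry [(0, B)] makes the norm bound one of the constraints,
and lets constraints be indexed by all natural numbers. *)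
Definition entry G (e : nat * seq (comb G * rat)) (i : nat) : comb G * rat :=
  nth ([::], e.1%:R) e.2 i.

Lemma ex_update (T : nat -> Type) (f : forall m, T m) n (x : T n) :
  exists g : forall m, T m, g n = x /\ forall m, m != n -> g m = f m.
Proof.
exists (@dfwith nat T f n x); split; first exact: dfwith_in.
by move=> m mn; apply: dfwith_out; rewrite eq_sym.
Qed.

Section functionals.
Variable R : realType.

Definition eval G (phi : G -> R) (v : comb G) : R :=
  \sum_(p <- v) ratr p.1 * phi p.2.

(** Consistency: [|v_j - v_k| <= r_j + r_k] in the norm whose dual ball is
[Phi]. *)
Definition admissible G (Phi : set (G -> R)) (e : nat * seq (comb G * rat)) :=
  forall phi, Phi phi -> forall i j,
    `|eval phi (entry e i).1 - eval phi (entry e j).1| <=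
      ratr (entry e i).2 + ratr (entry e j).2.

Definition compatible G (Phi : set (G -> R)) (phi : G -> R)
    (e : nat * seq (comb G * rat)) (t : R) :=
  `|t| <= e.1%:R /\ (admissible Phi e ->
    forall i, `|t - eval phi (entry e i).1| <= ratr (entry e i).2).

Definition ext_dual_ball G (Phi : set (G -> R)) : set (ext G -> R) :=
  [set psi | Phi (fun g => psi (inl g)) /\
     forall e, compatible Phi (fun g => psi (inl g)) e (psi (inr e))].

(** The dual ball of level [n], as a set of functions on the generators. At
level 0 it is a product of intervals, so the base generators span a copy of
[l_1]. *)
Fixpoint dual_ball n I : set (gen n I -> R) :=
  if n is m.+1 then ext_dual_ball (@dual_ball m I) else [set phi | forall i, `|phi i| <= 1].

Lemma eval_nil G (phi : G -> R) : eval phi [::] = 0.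
Proof. by rewrite /eval big_nil. Qed.

Lemma eval_cat G (phi : G -> R) v w : eval phi (v ++ w) = eval phi v + eval phi w.
Proof. by rewrite /eval big_cat. Qed.

Lemma eval_scale G (phi : G -> R) q v :
  eval phi [seq (q * p.1, p.2) | p <- v] = ratr q * eval phi v.
Proof.
rewrite /eval big_map mulr_sumr; apply: eq_bigr => p _.
by rewrite rmorphM mulrA.
Qed.

Lemma entry_default G (e : nat * seq (comb G * rat)) :
  entry e (size e.2) = ([::], e.1%:R).
Proof. by rewrite /entry nth_default. Qed.

(** The intervals of centre [phi v_k] and radius [r_k] meet pairwise by
admissibility, hence have a common point: the supremum of their lower ends.
The norm bound is the constraint given by the default entry. *)
Lemma ex_compatible G (Phi : set (G -> R)) phi e : Phi phi ->
  exists t, compatible Phi phi e t.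
Proof.
move=> Pphi.
have [adm|nadm] := pselect (admissible Phi e); last first.
  by exists 0; split => //; rewrite normr0.
pose S := [set eval phi (entry e i).1 - ratr (entry e i).2 | i in [set: nat]].
have S0 : S !=set0 by exists (eval phi (entry e 0).1 - ratr (entry e 0).2), 0%N.
have ubS i : ubound S (eval phi (entry e i).1 + ratr (entry e i).2).
  move=> _ [j _ <-]; have := adm _ Pphi j i.
  by move=> /(le_trans (ler_norm _)); lra.
have h i : `|sup S - eval phi (entry e i).1| <= ratr (entry e i).2.
  have h1 : sup S <= eval phi (entry e i).1 + ratr (entry e i).2.
    exact: ge_sup.
  have h2 : eval phi (entry e i).1 - ratr (entry e i).2 <= sup S.
    by apply: ub_le_sup; [exists (eval phi (entry e 0).1 + ratr (entry e 0).2)|exists i].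
  by rewrite ler_norml; apply/andP; split; lra.
exists (sup S); split => //.
by have := h (size e.2); rewrite entry_default /= eval_nil subr0 ratr_nat.
Qed.

(** A new generator can be given any value that its own constraints allow,
because the new generators of one level are not related to one another. *)
Lemma ext_dual_ball_value G (Phi : set (G -> R)) phi e t : Phi phi ->
  compatible Phi phi e t ->
  exists psi, [/\ ext_dual_ball Phi psi, (fun g => psi (inl g)) = phi & psi (inr e) = t].
Proof.
move=> Pphi et.
have [f fP] := choice (fun e' => @ex_compatible G Phi phi e' Pphi).
exists (fun x => match x with inl g => phi g
                | inr e' => if `[< e' = e >] then t else f e' end).
split => //; last by case: asboolP.
by split => // e' /=; case: asboolP => [->|].
Qed.

(** The dual ball of the union of the levels: functionals of all levels that
restrict to one another. *)
Definition functional_family I : Type :=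
  {phi : forall n, gen n I -> R |
    forall n, @dual_ball n I (phi n) /\ (fun g => phi n.+1 (inl g)) = phi n}.

Lemma partial_family I n (phi : gen n I -> R) : @dual_ball n I phi ->
  exists theta : forall m, gen m I -> R,
   [/\ forall m, (m <= n)%N -> @dual_ball m I (theta m),
       forall m, (m < n)%N -> (fun g => theta m.+1 (inl g)) = theta m &
       theta n = phi].
Proof.
elim: n phi => [|n IH] phi Pphi.
  have [g [g0 _]] := ex_update (T := fun m => gen m I -> R) (fun _ _ => 0) phi.
  exists g; split => // m; rewrite leqn0 => /eqP ->; rewrite g0.
  exact: Pphi.
have [theta [t1 t2 t3]] := IH _ Pphi.1.
have [g [gn gE]] := ex_update (T := fun m => gen m I -> R) theta phi.
exists g; split => // m.
  rewrite leq_eqVlt => /orP[/eqP->|mn]; first by rewrite gn; exact: Pphi.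
  by rewrite gE ?ltn_eqF//; exact: t1.
rewrite ltnS leq_eqVlt => /orP[/eqP->|mn].
  by rewrite gn gE ?ltn_eqF.
by rewrite !gE ?ltn_eqF//; [exact: t2|rewrite ltnS ltnW].
Qed.

(** Restriction downwards and step by step extension upwards turn a functional
of one level into one of the whole space; so the norm of a combination of
generators of level [n] can be computed with [dual_ball n] alone. *)
Lemma dual_ball_extends I n (phi : gen n I -> R) : @dual_ball n I phi ->
  exists psi : functional_family I, sval psi n = phi.
Proof.
move=> /partial_family[theta [t1 t2 t3]].
have step m (chi : gen m I -> R) : exists chi' : gen m.+1 I -> R,
    @dual_ball m I chi -> @dual_ball m.+1 I chi' /\ (fun g => chi' (inl g)) = chi.
  have [Pchi|nPchi] := pselect (@dual_ball m I chi); last by exists (fun=> 0).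
  (* An arbitrary generator: only the extension matters, not the prescribed value. *)
  have [t et] := ex_compatible (0%N, [::]) Pchi.
  have [chi' [? ? _]] := ext_dual_ball_value Pchi et.
  by exists chi'.
pose ex m := projT1 (choice (@step m)).
have exP m := projT2 (choice (@step m)).
pose fix psi m : gen m I -> R := if m is m'.+1 return gen m I -> R then
  if (m' < n)%N then theta m'.+1 else ex m' (psi m') else theta 0%N.
have psiE m : (m <= n)%N -> psi m = theta m by case: m => //= m ->.
have psiP m : @dual_ball m I (psi m) /\ (fun g => psi m.+1 (inl g)) = psi m.
  elim: m => [|m [IH1 IH2]] /=.
    split; first exact: (t1 0%N).
    case: ifPn => n0; first exact: (t2 0%N).
    by have /= [|_ ->] := exP 0%N (theta 0%N); first exact: (t1 0%N).
  have Pm : dual_ball (psi m.+1).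
    rewrite /=; case: ifPn => mn; first exact: (t1 m.+1).
    by have [] := exP m (psi m) IH1.
  split => //; case: ifPn => mn; first by rewrite (ltnW mn); exact: (t2 m.+1).
  by have [_ ->] := exP m.+1 (psi m.+1) Pm.
by exists (exist _ psi psiP) => /=; rewrite psiE.
Qed.

End functionals.

(** * The space spanned by the generators *)

Section generated_space.
Variables (R : realType) (I : Type).

Local Notation Lam := (functional_family R I).

Definition ev n (v : comb (gen n I)) : Lam -> R := fun phi => eval (sval phi n) v.

Lemma ev_lift n m (v : comb (gen n I)) : (n <= m)%N ->
  exists w : comb (gen m I), ev w = ev v.
Proof.
elim: m => [|m IH]; first by rewrite leqn0 => /eqP n0; subst n; exists v.
rewrite leq_eqVlt => /orP[/eqP nm|]; first by subst n; exists v.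
rewrite ltnS => /IH[w <-].
exists [seq (p.1, inl p.2) | p <- w]; apply/funext => -[phi phiP].
by rewrite /ev /= /eval big_map /=; have [_ <-] := phiP m.
Qed.

Lemma ev_lift2 n m (v : comb (gen n I)) (w : comb (gen m I)) :
  exists k (v' w' : comb (gen k I)), ev v' = ev v /\ ev w' = ev w.
Proof.
have [v' v'E] := ev_lift v (leq_maxl n m).
have [w' w'E] := ev_lift w (leq_maxr n m).
by exists (maxn n m), v', w'.
Qed.

Lemma dual_ball_bounded n (g : gen n I) : exists M : R, forall phi : gen n I -> R,
  dual_ball phi -> `|phi g| <= M.
Proof.
elim: n g => [|n IH] g; first by exists 1 => phi /(_ g).
case: g => [g|e].
  by have [M MP] := IH g; exists M => phi [/MP].
by exists e.1%:R => phi [_ /(_ e)[]].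
Qed.

Lemma ev_bounded n (v : comb (gen n I)) : exists M : R, forall phi, `|ev v phi| <= M.
Proof.
elim: v => [|[q g] v [M MP]].
  by exists 0 => phi; rewrite /ev eval_nil normr0.
have [K KP] := dual_ball_bounded g.
exists (`|ratr q| * K + M) => phi.
rewrite /ev -cat1s eval_cat (le_trans (ler_normD _ _))// lerD//; last exact: MP.
rewrite /eval big_seq1 normrM ler_wpM2l//.
by apply: KP; have [] := svalP phi n.
Qed.

Definition approximable (F : Lam -> R) := forall eps : R, 0 < eps ->
  exists n (v : comb (gen n I)), forall phi, `|F phi - ev v phi| <= eps.

Definition approximableb : {pred Lam -> R^o} := fun F => `[< approximable F >].

Lemma approximable_ev n (v : comb (gen n I)) : approximable (ev v).
Proof. by move=> eps e0; exists n, v => phi; rewrite subrr normr0 ltW. Qed.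

Lemma approximable_bounded F : approximable F ->
  exists M : R, forall phi, `|F phi| <= M.
Proof.
move=> /(_ 1 ltr01)[n [v vP]]; have [M MP] := ev_bounded v.
exists (1 + M) => phi.
by rewrite -[F phi](subrK (ev v phi)) (le_trans (ler_normD _ _))// lerD.
Qed.

Lemma rat_approx (a : R) (eps : R) : 0 < eps -> exists q : rat, `|a - ratr q| <= eps.
Proof.
move=> e0; have [|q] := @rat_in_itvoo _ (a - eps) (a + eps); first by lra.
rewrite in_itv /= => /andP[h1 h2].
by exists q; rewrite ler_norml; apply/andP; split; lra.
Qed.

(** The approximating combinations are rational; real coefficients are reached
because each combination is bounded on the dual ball. *)
Lemma approximable_linear : submod_closed approximableb.
Proof.
split.
  apply/asboolP => eps e0; exists 0%N, [::] => phi.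
  by rewrite /ev eval_nil subr0 normr0 ltW.
move=> a F1 F2 /asboolP h1 /asboolP h2; apply/asboolP => eps e0.
have e3 : 0 < eps / 3 by rewrite divr_gt0.
have a1 : 0 < `|a| + 1 by rewrite ltr_wpDl.
have [n1 [v1 v1P]] := h1 _ (divr_gt0 e3 a1).
have [n2 [v2 v2P]] := h2 _ e3.
have [M MP] := ev_bounded v1.
have M1 : 0 < `|M| + 1 by rewrite ltr_wpDl.
have [q qP] := rat_approx a (divr_gt0 e3 M1).
have [k [w1 [w2 [w1E w2E]]]] := ev_lift2 v1 v2.
exists k, ([seq (q * p.1, p.2) | p <- w1] ++ w2) => phi.
rewrite [ev (_ ++ _) _]/ev eval_cat eval_scale -/(ev w1 phi) -/(ev w2 phi) w1E w2E.
have -> : (a *: F1 + F2) phi - (ratr q * ev v1 phi + ev v2 phi) =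
    a * (F1 phi - ev v1 phi) + (a - ratr q) * ev v1 phi + (F2 phi - ev v2 phi).
  rewrite (_ : (a *: F1 + F2) phi = a * F1 phi + F2 phi)//; ring.
have -> : eps = eps / 3 + eps / 3 + eps / 3 by field.
rewrite (le_trans (ler_normD _ _))// lerD//.
rewrite (le_trans (ler_normD _ _))// lerD// normrM.
  apply: (@le_trans _ _ ((`|a| + 1) * (eps / 3 / (`|a| + 1)))).
    by apply: ler_pM => //; rewrite lerDl.
  by rewrite mulrC divfK ?gt_eqF.
apply: (@le_trans _ _ (eps / 3 / (`|M| + 1) * (`|M| + 1))).
  apply: ler_pM => //; rewrite (le_trans (MP phi))// (le_trans (ler_norm _))//.
  by rewrite lerDl.
by rewrite divfK ?gt_eqF.
Qed.

HB.instance Definition _ :=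
  GRing.isSubmodClosed.Build R (Lam -> R^o) approximableb approximable_linear.

Record gen_space : Type := GenSpace {
  gen_space_fun : Lam -> R^o;
  _ : gen_space_fun \in approximableb }.

HB.instance Definition _ := [isSub for gen_space_fun].
HB.instance Definition _ := [Choice of gen_space by <:].
HB.instance Definition _ := [SubChoice_isSubLmodule of gen_space by <:].

End generated_space.

(** * The sup norm and completeness *)

Section generated_space_norm.
Variables (R : realType) (I : Type).

Local Notation Lam := (functional_family R I).
Local Notation E := (gen_space R I).

Lemma zero_family : inhabited Lam.
Proof.
have [psi _] := @dual_ball_extends R I 0%N (fun=> 0) (fun=> ltac:(by rewrite normr0)).
exact: inhabits psi.
Qed.

Definition sup_norm (x : E) : R := sup [set `|val x phi| | phi in [set: Lam]].

Lemma sup_norm_le x (M : R) : (forall phi, `|val x phi| <= M) -> sup_norm x <= M.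
Proof.
move=> xM; have [phi0] := zero_family.
apply: ge_sup; first by exists `|val x phi0|, phi0.
by move=> _ [phi _ <-].
Qed.

Lemma le_sup_norm x phi : `|val x phi| <= sup_norm x.
Proof.
apply: ub_le_sup; last by exists phi.
have [M MP] : exists M : R, forall phi, `|val x phi| <= M.
  by apply: approximable_bounded; apply/asboolP; exact: (valP x).
by exists M => _ [psi _ <-].
Qed.

Lemma sup_normD x y : sup_norm (x + y) <= sup_norm x + sup_norm y.
Proof.
apply: sup_norm_le => phi.
rewrite (_ : val (x + y) phi = val x phi + val y phi)//.
by rewrite (le_trans (ler_normD _ _))// lerD// le_sup_norm.
Qed.

Lemma sup_normZ (a : R) x : sup_norm (a *: x) = `|a| * sup_norm x.
Proof.
have le b y : sup_norm (b *: y) <= `|b| * sup_norm y.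
  apply: sup_norm_le => phi; rewrite (_ : val (b *: y) phi = b * val y phi)//.
  by rewrite normrM ler_wpM2l// le_sup_norm.
apply/eqP; rewrite eq_le le/=.
have [->|a0] := eqVneq a 0.
  have [phi0] := zero_family.
  by rewrite normr0 mul0r (le_trans _ (le_sup_norm _ phi0)).
rewrite -ler_pdivlMl ?normr_gt0//.
by have := le a^-1 (a *: x); rewrite scalerA mulVf// scale1r normfV.
Qed.

Lemma sup_norm_eq0 x : sup_norm x = 0 -> x = 0.
Proof.
move=> x0; apply/val_inj/funext => phi; apply/eqP.
by rewrite -normr_le0 -[leRHS]x0 le_sup_norm.
Qed.

HB.instance Definition _ :=
  Lmodule_isNormed.Build R E sup_normD sup_normZ sup_norm_eq0.

Lemma gen_norm_le (x : E) (M : R) : (forall phi, `|val x phi| <= M) -> `|x| <= M.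
Proof. exact: sup_norm_le. Qed.

Lemma le_gen_norm (x : E) phi : `|val x phi| <= `|x|.
Proof. exact: le_sup_norm. Qed.

(** A Cauchy filter converges pointwise on the dual ball, and the convergence
is uniform; a uniform limit of approximable functions is approximable. *)
Lemma gen_space_complete (F : set_system E) : ProperFilter F -> cauchy F -> cvg F.
Proof.
move=> FF /cauchyP Fc.
have Fex (eps : R) : 0 < eps -> exists x : E, F [set y | `|x - y| <= eps].
  move=> e0; have [x xF] := Fc _ e0.
  exists x; apply: filterS xF => y; rewrite -ball_normE /= => /ltW //.
have ptc phi : exists l : R, forall eps : R, 0 < eps ->
    F [set y | `|l - val y phi| <= eps].
  have : cvg ((fun y : E => val y phi : R) @ F).
    apply: cauchy_cvg; apply: cauchy_exP => eps e0.
    have e20 : 0 < eps / 2 by rewrite divr_gt0.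
    have [x xF] := Fex _ e20; exists (val x phi).
    suff : F [set y | ball (val x phi : R) eps (val y phi)] by [].
    apply: filterS xF => y /= xy; rewrite -ball_normE /=.
    apply: (@le_lt_trans _ _ `|x - y|); first exact: (le_gen_norm (x - y)).
    by rewrite (le_lt_trans xy)//; lra.
  move=> /cvg_ex[l /cvgrPdist_le lF]; exists l => eps e0; exact: (lF _ e0).
have [l lP] := choice ptc.
have near_l (eps : R) x phi : F [set y | `|x - y| <= eps] -> `|val x phi - l phi| <= eps.
  move=> xF; apply/ler_addgt0Pr => eta eta0.
  have [y [/= xy ly]] := filter_ex (filterI xF (lP phi _ eta0)).
  have -> : val x phi - l phi = (val x phi - val y phi) - (l phi - val y phi).
    by ring.
  rewrite (le_trans (ler_normB _ _))// lerD//.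
  by apply: le_trans xy; exact: (le_gen_norm (x - y)).
have lE : (l : Lam -> R^o) \in @approximableb R I.
  apply/asboolP => eps e0.
  have e20 : 0 < eps / 2 by rewrite divr_gt0.
  have [x xF] := Fex _ e20.
  have /asboolP/(_ _ e20)[n [v vP]] := valP x.
  exists n, v => phi.
  rewrite -[l phi](subrK (val x phi)) -addrA (le_trans (ler_normD _ _))//.
  by rewrite [leRHS]splitr lerD// distrC near_l.
apply/cvg_ex; exists (GenSpace lE); apply/cvgrPdist_le => eps e0.
have e20 : 0 < eps / 2 by rewrite divr_gt0.
have [x xF] := Fex _ e20.
near=> y.
rewrite -[X in `|X - y|](subrK x) -addrA (le_trans (ler_normD _ _))//.
rewrite [leRHS]splitr lerD//; last by near: y.
rewrite distrC; apply: gen_norm_le => phi; exact: near_l.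
Unshelve. all: by end_near. Qed.

HB.instance Definition _ := Uniform_isComplete.Build E gen_space_complete.

End generated_space_norm.

(** * Functoriality in the set of base generators *)

Definition comb_map G H (f : G -> H) (v : comb G) : comb H := [seq (p.1, f p.2) | p <- v].

Definition ext_map G H (f : G -> H) (x : ext G) : ext H :=
  match x with
  | inl g => inl (f g)
  | inr e => inr (e.1, [seq (comb_map f p.1, p.2) | p <- e.2])
  end.

Fixpoint gen_map n I J (f : I -> J) : gen n I -> gen n J :=
  if n is m.+1 then ext_map (@gen_map m I J f) else f.

Lemma comb_map_comp G H K (f : G -> H) (g : H -> K) v :
  comb_map g (comb_map f v) = comb_map (g \o f) v.
Proof. by rewrite /comb_map -map_comp. Qed.

Lemma comb_map_id G v : comb_map (@id G) v = v.
Proof. by rewrite -[RHS]map_id; apply: eq_map => -[]. Qed.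

Lemma gen_map_comp n I J K (f : I -> J) (h : J -> K) g :
  gen_map (n := n) h (gen_map f g) = gen_map (h \o f) g.
Proof.
have -> : gen_map (h \o f) = gen_map (n := n) h \o gen_map f; last by [].
elim: n {g} => [//|n IH]; apply/funext => -[g|[B l]] /=; rewrite IH//.
congr (inr (_, _)); rewrite -map_comp; apply: eq_map => p /=.
by rewrite comb_map_comp.
Qed.

Lemma gen_map_id n I g : gen_map (n := n) (@id I) g = g.
Proof.
have -> : gen_map (n := n) (@id I) = id; last by [].
elim: n {g} => [//|n IH]; apply/funext => -[g|[B l]] /=; rewrite IH//.
congr (inr (_, _)); rewrite -[RHS]map_id; apply: eq_map => -[v q] /=.
by rewrite comb_map_id.
Qed.

Lemma comb_gen_map_comp n I J K (f : I -> J) (h : J -> K) (v : comb (gen n I)) :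
  comb_map (gen_map h) (comb_map (gen_map f) v) = comb_map (gen_map (h \o f)) v.
Proof.
by rewrite comb_map_comp; congr comb_map; apply/funext => g /=; rewrite gen_map_comp.
Qed.

Lemma comb_gen_map_id n I (v : comb (gen n I)) : comb_map (gen_map id) v = v.
Proof.
by rewrite -[RHS]comb_map_id; congr comb_map; apply/funext => g; exact: gen_map_id.
Qed.

Section finite_support.
Variable I : eqType.

Lemma finite_support_map (A B C : Type) (F : (I -> C) -> A -> B) :
  (forall a, exists s : seq I, forall f f', {in s, f =1 f'} -> F f a = F f' a) ->
  forall l : seq A, exists s : seq I, forall f f', {in s, f =1 f'} ->
    map (F f) l = map (F f') l.
Proof.
move=> FP; elim=> [|a l [s sP]]; first by exists [::].
have [t tP] := FP a; exists (t ++ s) => f f' ff' /=.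
by congr cons; [apply: tP|apply: sP] => i si; apply: ff'; rewrite mem_cat si ?orbT.
Qed.

Lemma comb_finite_support (G H C : Type) (F : (I -> C) -> G -> H) :
  (forall a, exists s : seq I, forall f f', {in s, f =1 f'} -> F f a = F f' a) ->
  forall v : comb G, exists s : seq I, forall f f', {in s, f =1 f'} ->
    comb_map (F f) v = comb_map (F f') v.
Proof.
move=> FP; apply: finite_support_map => -[q g].
by have [s sP] := FP g; exists s => f f' /sP /= ->.
Qed.

(** Finite support, expressed through the action of maps so that no support
has to be computed. *)
Lemma gen_finite_support J n (g : gen n I) : exists s : seq I,
  forall f f' : I -> J, {in s, f =1 f'} -> gen_map f g = gen_map f' g.
Proof.
elim: n g => [|n IH] g.
  by exists [:: g] => f f' ff' /=; apply: ff'; rewrite mem_seq1.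
case: g => [g|[B l]].
  by have [s sP] := IH g; exists s => f f' /sP /= ->.
have [|s sP] := @finite_support_map _ _ J
    (fun f p => (comb_map (gen_map (n := n) f) p.1, p.2)) _ l.
  move=> [v q]; have [s sP] := comb_finite_support IH v.
  by exists s => f f' /sP /= ->.
by exists s => f f' /sP /= ->.
Qed.

End finite_support.

Section functoriality.
Variable R : realType.

Lemma eval_map G H (f : G -> H) (phi : H -> R) v :
  eval phi (comb_map f v) = eval (fun g => phi (f g)) v.
Proof. by rewrite /eval big_map. Qed.

Lemma entry_map G H (f : G -> H) B l i :
  entry (B, [seq (comb_map f p.1, p.2) | p <- l]) i =
  (comb_map f (entry (B, l) i).1, (entry (B, l) i).2).
Proof.
by rewrite /entry /=; elim: l i => [|p l IH] [|i] /=.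
Qed.

(** This is the point of imposing the constraints conditionally: if [e] is
consistent, so is its image, since functionals downstream pull back to
functionals upstream; if [e] is inconsistent, only its norm bound, which is
also that of its image, is at stake. *)
Lemma dual_ball_map I J (f : I -> J) n (phi : gen n J -> R) : dual_ball phi ->
  dual_ball (fun g : gen n I => phi (gen_map f g)).
Proof.
elim: n phi => [|n IH] phi; first by move=> h i; exact: h.
move=> [h1 h2]; split; first exact: (IH _ h1).
move=> [B l] /=.
have [h3 h4] := h2 (B, [seq (comb_map (gen_map f) p.1, p.2) | p <- l]).
split; first exact: h3.
move=> adm i.
have := h4 _ i; rewrite entry_map /= eval_map; apply.
move=> psi Ppsi j k; rewrite !entry_map /= !eval_map.
exact: adm (IH _ Ppsi) j k.
Qed.

Definition pullback I J (f : I -> J) (psi : functional_family R J) :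
  functional_family R I.
Proof.
exists (fun n g => sval psi n (gen_map f g)) => n.
have [h1 h2] := svalP psi n; split; first exact: dual_ball_map.
by apply/funext => g; rewrite -[in RHS]h2.
Defined.

Lemma functional_family_eq I (phi psi : functional_family R I) :
  (forall n g, sval phi n g = sval psi n g) -> phi = psi.
Proof.
case: phi psi => [phi hphi] [psi hpsi] /= h; apply: eq_exist.
by apply: functional_extensionality_dep => n; apply/funext => g; exact: h.
Qed.

Lemma pullback_comp I J K (f : I -> J) (h : J -> K) psi :
  pullback f (pullback h psi) = pullback (h \o f) psi.
Proof. by apply: functional_family_eq => n g /=; rewrite gen_map_comp. Qed.

Lemma ev_map I J (f : I -> J) n (v : comb (gen n I)) (psi : functional_family R J) :
  ev (comb_map (gen_map f) v) psi = ev v (pullback f psi).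
Proof. by rewrite /ev eval_map. Qed.

Lemma approximable_map I J (f : I -> J) (x : gen_space R I) :
  (fun psi => val x (pullback f psi) : R^o) \in @approximableb R J.
Proof.
apply/asboolP => eps e0; have /asboolP/(_ _ e0)[n [v vP]] := valP x.
by exists n, (comb_map (gen_map f) v) => psi; rewrite ev_map.
Qed.

Definition gen_space_map_fun I J (f : I -> J) (x : gen_space R I) : gen_space R J :=
  GenSpace (approximable_map f x).

Lemma gen_space_map_linear I J (f : I -> J) : linear (gen_space_map_fun f).
Proof. by move=> a x y; apply/val_inj. Qed.

HB.instance Definition _ I J (f : I -> J) :=
  GRing.isLinear.Build R (gen_space R I) (gen_space R J) _ (gen_space_map_fun f)
    (gen_space_map_linear f).

Definition gen_space_map I J (f : I -> J) : {linear gen_space R I -> gen_space R J} :=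
  gen_space_map_fun f.

Lemma gen_space_mapE I J (f : I -> J) x psi :
  val (gen_space_map f x) psi = val x (pullback f psi).
Proof. by []. Qed.

Lemma gen_space_map_comp I J K (f : I -> J) (h : J -> K) x :
  gen_space_map h (gen_space_map f x) = gen_space_map (h \o f) x.
Proof.
by apply/val_inj/funext => psi; rewrite !gen_space_mapE pullback_comp.
Qed.

Lemma gen_space_map_contraction I J (f : I -> J) x : `|gen_space_map f x| <= `|x|.
Proof. by apply: gen_norm_le => psi; rewrite gen_space_mapE le_gen_norm. Qed.

Lemma ev_approximable I n (v : comb (gen n I)) : (ev v : _ -> R^o) \in @approximableb R I.
Proof. by apply/asboolP; exact: approximable_ev. Qed.

Definition gev I n (v : comb (gen n I)) : gen_space R I := GenSpace (ev_approximable v).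

Lemma gev_dense I (x : gen_space R I) (eps : R) : 0 < eps ->
  exists n (v : comb (gen n I)), `|x - gev v| <= eps.
Proof.
move=> e0; have /asboolP/(_ _ e0)[n [v vP]] := valP x.
by exists n, v; apply: gen_norm_le.
Qed.

Lemma gen_space_map_gev I J (f : I -> J) n (v : comb (gen n I)) :
  gen_space_map f (gev v) = gev (comb_map (gen_map f) v).
Proof. by apply/val_inj/funext => psi; rewrite gen_space_mapE /= ev_map. Qed.

End functoriality.

(** * Metric extension by one new generator *)

Section one_point_extension.
Variables (R : realType) (I : Type).
Local Notation E := (gen_space R I).

Definition gen_vec n (g : gen n I) : E := gev R [:: (1, g)].

Lemma gen_vecE n (g : gen n I) psi : val (gen_vec g) psi = sval psi n g.
Proof. by rewrite /= /ev /eval big_seq1 /= rmorph1 mul1r. Qed.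

Lemma gen_vec_inl n (g : gen n I) : gen_vec (n := n.+1) (inl g) = gen_vec g.
Proof.
apply/val_inj/funext => psi; rewrite !gen_vecE.
by have [_ <-] := svalP psi n.
Qed.

Lemma gev_nil n : gev R (n := n) (I := I) [::] = 0.
Proof. by apply/val_inj/funext => psi; rewrite /= /ev eval_nil. Qed.

Lemma gev_cons n p (v : comb (gen n I)) :
  gev R (p :: v) = ratr p.1 *: gen_vec p.2 + gev R v.
Proof.
apply/val_inj/funext => psi.
rewrite (_ : val (_ + _) psi = ratr p.1 * val (gen_vec p.2) psi + val (gev R v) psi)//.
by rewrite gen_vecE /= /ev /eval big_cons.
Qed.

Lemma gen_vec_dist n (e : nat * seq (comb (gen n I) * rat)) i :
  admissible (@dual_ball R n I) e ->
  `|gen_vec (n := n.+1) (inr e) - gev R (entry e i).1| <= ratr (entry e i).2.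
Proof.
move=> adm; apply: gen_norm_le => psi.
rewrite (_ : val (_ - _) psi = val (gen_vec (n := n.+1) (inr e)) psi
  - val (gev R (entry e i).1) psi)// gen_vecE /= /ev.
have [[_ /(_ e)[_ h]] _] := svalP psi n.+1.
have [_ <-] := svalP psi n.
exact: h.
Qed.

Variable h : {linear E -> R^o}.
Hypothesis h_contraction : forall x, `|h x| <= `|x|.

Lemma eval_functional n (v : comb (gen n I)) :
  eval (fun g => h (gen_vec g)) v = h (gev R v).
Proof.
elim: v => [|p v IH]; first by rewrite eval_nil gev_nil linear0.
by rewrite gev_cons linearD linearZ -IH /eval big_cons.
Qed.

(** Conversely, every linear contraction is a point of the dual ball, because
the constraints defining it are norm inequalities valid in the space. *)
Lemma dual_ball_functional n : dual_ball (fun g : gen n I => h (gen_vec g)).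
Proof.
elim: n => [|n IH].
  move=> i; apply: le_trans (h_contraction _) _; apply: gen_norm_le => psi.
  by rewrite gen_vecE; have [/(_ i)] := svalP psi 0%N.
have E1 : (fun g : gen n I => h (gen_vec (n := n.+1) (inl g))) = (fun g => h (gen_vec g)).
  by apply/funext => g; rewrite gen_vec_inl.
split; rewrite E1 // => e; split.
  apply: le_trans (h_contraction _) _; apply: gen_norm_le => psi.
  by rewrite gen_vecE; have [[_ /(_ e)[]]] := svalP psi n.+1.
move=> adm i; rewrite eval_functional -linearB.
by apply: le_trans (h_contraction _) _; exact: gen_vec_dist.
Qed.

(** A contraction [h], restricted to the generators of level [n], can be
prescribed at the new generator [e]. The resulting point of the dual ball
agrees with [h] on level [n] only. *)
Lemma extend_functional n (e : nat * seq (comb (gen n I) * rat)) (t : R) :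
  (forall i, `|t - h (gev R (entry e i).1)| <= ratr (entry e i).2) ->
  exists psi : functional_family R I, val (gen_vec (n := n.+1) (inr e)) psi = t /\
    forall v : comb (gen n I), val (gev R v) psi = h (gev R v).
Proof.
move=> ht.
have [|phi [dphi phiE phie]] := @ext_dual_ball_value R _ (@dual_ball R n I) _ e t (@dual_ball_functional n).
  split; last by move=> _ i; rewrite eval_functional.
  by have := ht (size e.2); rewrite entry_default gev_nil linear0 subr0 ratr_nat.
have [psi psiE] := @dual_ball_extends R I n.+1 phi dphi.
exists psi; split; first by rewrite gen_vecE psiE.
move=> v; rewrite -eval_functional -phiE -psiE /= /ev.
by have [_ <-] := svalP psi n.
Qed.

End one_point_extension.

Lemma admissible_dist (R : realType) I n (e : nat * seq (comb (gen n I) * rat)) :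
  (forall i j, `|gev R (entry e i).1 - gev R (entry e j).1| <=
     ratr (entry e i).2 + ratr (entry e j).2) ->
  admissible (@dual_ball R n I) e.
Proof.
move=> he phi dphi i j; have [psi psiE] := dual_ball_extends dphi.
apply: le_trans (he i j).
rewrite -psiE; exact: (le_gen_norm (gev R (entry e i).1 - gev R (entry e j).1) psi).
Qed.

Lemma le_add_slack (R : realType) (c x a b y eps : R) : 0 <= c ->
  x <= eps + a -> a <= c * b -> b <= eps + y -> x <= c * y + (1 + c) * eps.
Proof. by move=> c0 h1 h2 h3; have := ler_wpM2l c0 h3; rewrite mulrDr; lra. Qed.

Section extension_to_closure.
Variables (R : realType) (I : Type) (T : normedModType R).
Local Notation E := (gen_space R I).

(** The constant measures the distortion in both directions, like [1 + e] for
an [e]-isometric embedding; the estimates make a graph single-valued and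
injective. *)
Definition bilipschitz (c : R) (z : T * E) := `|z.1| <= c * `|z.2| /\ `|z.2| <= c * `|z.1|.

Lemma bilipschitzZ c (a : R) z : bilipschitz c z -> bilipschitz c (a *: z).
Proof.
move=> [h1 h2]; split => /=; rewrite !normrZ mulrCA ler_wpM2l//.
Qed.

Lemma bilipschitz_le c c' z : c <= c' -> bilipschitz c z -> bilipschitz c' z.
Proof.
move=> cc' [h1 h2]; split.
  by apply: le_trans h1 _; rewrite ler_wpM2r.
by apply: le_trans h2 _; rewrite ler_wpM2r.
Qed.

(** When [t0] is a limit of the domain, its image is forced to be the limit of
the images, which exists by completeness, and the constant is not lost. *)
Lemma extension_closure (G : set (T * E)) (c : R) (t0 : T) : linear_graph G ->
  0 < c -> (forall z, G z -> bilipschitz c z) ->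
  (forall d : R, 0 < d -> exists2 z, G z & `|t0 - z.1| < d) ->
  exists y0, forall z, G z -> bilipschitz c ((t0, y0) - z).
Proof.
move=> lG c0 Gc Gt0.
pose B (d : R) : set E := [set z.2 | z in [set z | G z /\ `|t0 - z.1| < d]].
pose F := filter_from [set d : R | 0 < d] B.
have FF : ProperFilter F.
  apply: filter_from_proper; last first.
    by move=> d /Gt0[z Gz zd]; exists z.2, z.
  apply: filter_from_filter; first by exists 1 => /=.
  move=> a b /= a0 b0; exists (Num.min a b) => /=; first by rewrite lt_min a0.
  by move=> _ [z [Gz]] + <-; rewrite lt_min => /andP[za zb]; split; exists z.
have FB d : 0 < d -> F (B d) by move=> d0; exists d.
have : cvg F.
  apply: cauchy_cvg; apply: cauchy_exP => eps e0.
  have d0 : 0 < eps / (c + c) by rewrite divr_gt0// addr_gt0.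
  have [z Gz zd] := Gt0 _ d0.
  exists z.2; apply: filterS (FB _ d0) => _ [w [Gw wd] <-].
  rewrite -ball_normE /=.
  have [_ /= h] := Gc _ (linear_graphB lG Gz Gw).
  apply: le_lt_trans h _.
  have -> : eps = c * (eps / (c + c) + eps / (c + c)).
    by field; rewrite gt_eqF// addr_gt0.
  rewrite ltr_pM2l//.
  have -> : z.1 - w.1 = (t0 - w.1) - (t0 - z.1).
    by rewrite opprB [RHS]addrC addrA subrK.
  by rewrite (le_lt_trans (ler_normB _ _))// ltrD.
move=> /cvg_ex[y0 Fy0]; exists y0 => z Gz.
have yF (eps : R) : 0 < eps -> F [set y | `|y0 - y| <= eps].
  move=> e0; apply: filterS (Fy0 _ (nbhsx_ballx y0 eps e0)) => y.
  by rewrite -ball_normE => /ltW.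
have key (eps : R) : 0 < eps -> exists w, [/\ G w, `|t0 - w.1| <= eps & `|y0 - w.2| <= eps].
  move=> e0; have [y [/= h [w [Gw we] wE]]] := filter_ex (filterI (yF _ e0) (FB _ e0)).
  by exists w; split => //; [exact: ltW|rewrite wE].
have tri (V : normedModType R) (x y w : V) (eps : R) : `|x - w| <= eps ->
    `|x - y| <= eps + `|w - y| /\ `|w - y| <= eps + `|x - y|.
  move=> xw; split.
    rewrite -[x - y](subrK (w - y)) (le_trans (ler_normD _ _))// lerD2r.
    by rewrite opprB addrA subrK.
  rewrite -[w - y](subrK (x - y)) (le_trans (ler_normD _ _))// lerD2r.
  by rewrite opprB addrA subrK distrC.
have fin (x y : R) : (forall eps, 0 < eps -> x <= y + (1 + c) * eps) -> x <= y.
  move=> xy; apply/ler_addgt0Pr => eps e0.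
  have c1 : 0 < 1 + c by rewrite addr_gt0.
  by have := xy _ (divr_gt0 e0 c1); rewrite mulrCA divff ?gt_eqF// mulr1.
split; apply: fin => eps e0 /=; have [w [Gw w1 w2]] := key _ e0.
  have [h1 h2] := Gc _ (linear_graphB lG Gw Gz).
  have [t1 _] := tri _ _ z.1 _ _ w1; have [_ t2] := tri _ _ z.2 _ _ w2.
  exact: le_add_slack (ltW c0) t1 h1 t2.
have [h1 h2] := Gc _ (linear_graphB lG Gw Gz).
have [_ t1] := tri _ _ z.1 _ _ w1; have [t2 _] := tri _ _ z.2 _ _ w2.
exact: le_add_slack (ltW c0) t2 h2 t1.
Qed.

End extension_to_closure.

Section approximate_extension.
Variables (R : realType) (I : Type) (T : normedModType R).
Local Notation E := (gen_space R I).

Lemma graph_nets (G : set (T * E)) (M del : R) : finite_nets [set: T] ->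
  linear_graph G -> 0 < del ->
  exists zs : seq (T * E), (forall i, G (nth 0 zs i)) /\
    forall z, G z -> `|z.1| <= M ->
      exists2 i, (i < size zs)%N & `|z.1 - (nth 0 zs i).1| <= del.
Proof.
move=> Tnets lG d0; have d20 : 0 < del / 2 by rewrite divr_gt0.
have [l lP] := Tnets M _ d20.
have /choice[f fP] (x : T) : exists w : T * E, G w /\
    ((exists2 z, G z & `|z.1 - x| <= del / 2) -> `|w.1 - x| <= del / 2).
  have [[z Gz zx]|nz] := pselect (exists2 z, G z & `|z.1 - x| <= del / 2).
    by exists z.
  by exists 0; split => //; case: lG.
exists [seq f x | x <- l]; split.
  move=> i; have [il|li] := ltnP i (size l).
    by rewrite (nth_map 0)//; have [] := fP (nth 0 l i).
  by rewrite nth_default ?size_map//; case: lG.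
move=> z Gz zM; have [x xl zx] := lP z.1 Logic.I zM.
exists (index x l); rewrite ?size_map ?(nth_map 0) ?index_mem// nth_index//.
have [_ fx] := fP x.
rewrite -[z.1](subrK x) -addrA (le_trans (ler_normD _ _))//.
by rewrite [leRHS]splitr lerD// distrC; apply: fx; exists z.
Qed.

Lemma gev_lift n m (v : comb (gen n I)) : (n <= m)%N ->
  exists w : comb (gen m I), gev R w = gev R v.
Proof.
by move=> nm; have [w wv] := ev_lift R v nm; exists w; apply/val_inj.
Qed.

(** Finitely many vectors can be approximated at one single level, because
lower levels embed into higher ones. *)
Lemma common_level (A : Type) (a0 : A) (P : A -> E * rat -> Prop) (s : seq A) :
  (forall a, exists n (v : comb (gen n I)) q, P a (gev R v, q)) ->
  exists n (l : seq (comb (gen n I) * rat)), size l = size s /\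
    forall d i, (i < size s)%N -> P (nth a0 s i) (gev R (nth d l i).1, (nth d l i).2).
Proof.
move=> PP.
suff [n0 /(_ n0 (leqnn _))[l lP]] : exists n0, forall n, (n0 <= n)%N ->
    exists l : seq (comb (gen n I) * rat), size l = size s /\
    forall d i, (i < size s)%N -> P (nth a0 s i) (gev R (nth d l i).1, (nth d l i).2).
  by exists n0, l.
elim: s => [|a s [n0 IH]]; first by exists 0%N => n _; exists [::].
have [n1 [v [q vq]]] := PP a.
exists (maxn n0 n1) => n; rewrite geq_max => /andP[/IH[l [lE lP]] /(gev_lift v)[w wv]].
exists ((w, q) :: l); split; first by rewrite /= lE.
by move=> d [|i] /= il; [rewrite wv|exact: lP].
Qed.

(** An additive error is absorbed in a slightly larger constant when [x] is
bounded away from 0. *)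
Lemma le_absorb_slack (x y c c' d k : R) : 0 < c -> c < c' -> d <= x ->
  x <= c * y + k -> c' * k <= (c' - c) * d -> x <= c' * y.
Proof.
move=> c0 cc' dx h1 h2.
have h3 : (c' - c) * d <= (c' - c) * x by apply: ler_wpM2l; lra.
have h4 : c' * x <= c' * (c * y + k) by apply: ler_wpM2l; lra.
have h5 : c * x <= c * (c' * y) by nra.
by rewrite ler_pM2l in h5.
Qed.

(** Far from the origin the estimates follow from the triangle inequality
alone: [a], [t], [x] are the norms of [t0], [z.1], [t0 - z.1], and [y0], [y],
[u] those of their images. *)
Lemma bilipschitz_far (c c' a t y0 y x u : R) : 1 <= c -> c < c' -> 0 <= a ->
  y0 <= c' * a -> y <= c * t -> t <= c * y ->
  t - a <= x -> x <= t + a -> u <= y + y0 -> y - y0 <= u ->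
  2 * c' * a / (c' - c) <= t ->
  c * (c' * a + (1 + c * c') * a / (c' - c)) <= t ->
  x <= c' * u /\ u <= c' * x.
Proof.
move=> c1 cc' a0 hy0 hy ht tx xt uy yu; rewrite ler_pdivrMr ?subr_gt0// => h1 h2.
split; last first.
  apply: (le_trans uy); apply: (@le_trans _ _ (c' * (t - a))); first by lra.
  by apply: ler_wpM2l => //; lra.
have y1 : c' * a + (1 + c * c') * a / (c' - c) <= y.
  by rewrite -(@ler_pM2l _ c); [exact: le_trans ht|lra].
have u1 : (1 + c * c') * a / (c' - c) <= u by lra.
rewrite ler_pdivrMr ?subr_gt0// in u1.
have h3 : c * y <= c * (u + c' * a) by apply: ler_wpM2l; lra.
lra.
Qed.

Lemma norm_add3 (V : normedModType R) (x y : V) (u v : V) (a b c : R) :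
  `|x - u| <= a -> `|u - v| <= b -> `|v - y| <= c -> `|x - y| <= a + b + c.
Proof.
move=> h1 h2 h3; have -> : x - y = (x - u) + (u - v) + (v - y).
  by rewrite !addrA !subrK.
by rewrite (le_trans (ler_normD _ _))// lerD// (le_trans (ler_normD _ _))// lerD.
Qed.

(** The heart of the Gurarii property. Here [y0] is a new generator; near the
given finitely many points, its distances to the range of the graph are those
of [t0] to the domain, up to the factor [c] and an additive error. *)
Lemma extension_approx (G : set (T * E)) (c : R) (t0 : T) (del : R)
    (zs : seq (T * E)) :
  linear_graph G -> 1 <= c -> (forall z, G z -> bilipschitz c z) -> 0 < del ->
  (forall i, G (nth 0 zs i)) ->
  exists y0 : E, forall z i, G z -> (i < size zs)%N -> `|z.1 - (nth 0 zs i).1| <= del ->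
    `|y0 - z.2| <= c * `|t0 - z.1| + (3 + 2 * c) * del /\
    `|t0 - z.1| <= c * `|y0 - z.2| + c * (2 + 2 * c) * del.
Proof.
move=> lG c1 Gc d0 Gzs; have c0 : 0 < c by lra.
pose P (z : T * E) (p : E * rat) := `|z.2 - p.1| <= del /\
  c * `|t0 - z.1| + del <= ratr p.2 <= c * `|t0 - z.1| + 2 * del.
have [z|n [l [lE lP]]] := common_level 0 (P := P) zs.
  have [n [v vz]] := gev_dense z.2 d0.
  have [|q] := @rat_in_itvoo _ (c * `|t0 - z.1| + del) (c * `|t0 - z.1| + 2 * del).
    lra.
  rewrite in_itv /= => /andP[q1 q2]; exists n, v, q; split => //=.
  by rewrite !ltW.
pose B := Num.bound (c * `|t0| + del).
have BP : c * `|t0| + del <= B%:R.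
  by apply/ltW/archi_boundP; rewrite addr_ge0 ?(ltW d0)// mulr_ge0// ltW.
pose e := (B, l); pose z_ i := nth 0 zs i.
pose x_ i := gev R (entry e i).1; pose r_ i : R := ratr (entry e i).2.
(* Beyond the net, z_ i and x_ i are 0 and r_ i is the norm bound B. *)
have zx i : `|(z_ i).2 - x_ i| <= del.
  rewrite /z_ /x_ /entry /=; have [il|li] := ltnP i (size zs); first exact: (lP _ _ il).1.
  by rewrite !nth_default ?lE//= gev_nil subrr normr0 ltW.
have zr i : c * `|t0 - (z_ i).1| + del <= r_ i.
  rewrite /z_ /r_ /entry /=; have [il|li] := ltnP i (size zs).
    by have [_ /andP[]] := lP ([::], B%:R) _ il.
  by rewrite !nth_default ?lE//= subr0 ratr_nat.
have zdist i j : `|(z_ i).2 - (z_ j).2| <= c * `|(z_ i).1 - (z_ j).1|.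
  by have [_] := Gc _ (linear_graphB lG (Gzs i) (Gzs j)).
have adm : admissible (@dual_ball R n I) e.
  apply: admissible_dist => i j; rewrite -/(x_ i) -/(x_ j) -/(r_ i) -/(r_ j).
  have h1 : `|x_ i - (z_ i).2| <= del by rewrite distrC.
  have := norm_add3 h1 (zdist i j) (zx j) => /le_trans; apply.
  have : `|(z_ i).1 - (z_ j).1| <= `|t0 - (z_ i).1| + `|t0 - (z_ j).1|.
    by rewrite [`|t0 - (z_ i).1|]distrC -[(z_ i).1 - _](subrKA t0) ler_normD.
  move=> /(ler_wpM2l (ltW c0)); rewrite mulrDr => h.
  by move: (zr i) (zr j) h; clear; set a := _ * _; lra.
pose y0 : E := gen_vec R (n := n.+1) (inr e).
exists y0 => z i Gz il zi.
have zz2 : `|(z_ i).2 - z.2| <= c * del.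
  have [_ /= h] := Gc _ (linear_graphB lG (Gzs i) Gz); apply: (le_trans h).
  by rewrite ler_wpM2l ?(ltW c0)// distrC.
have xz : `|x_ i - (z_ i).2| <= del by rewrite distrC.
have tz : `|t0 - (z_ i).1| <= `|t0 - z.1| + del.
  by rewrite -(subrKA z.1) (le_trans (ler_normD _ _))// lerD2l.
have ri : r_ i <= c * `|t0 - (z_ i).1| + 2 * del.
  have [_ /andP[_]] := lP ([::], B%:R) _ il.
  by rewrite /r_ /entry.
split.
  have := norm_add3 (gen_vec_dist i adm) xz zz2 => /le_trans; apply.
  move/(ler_wpM2l (ltW c0)) : tz; rewrite mulrDr -/(r_ i) => tz.
  by move: ri tz; clear; lra.
have [f [f1 ft]] := norming_functional (t0 - z.1).
(* The functional f / c of the domain, transported to the range, is a contraction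
   because |t| <= c |y| on the graph. *)
pose H : set (E * R^o) := [set (w.2, c^-1 * f w.1 : R^o) | w in G].
have lH : linear_graph H.
  have [G0 GL] := lG; split; first by exists 0 => //=; rewrite linear0 mulr0.
  move=> a _ _ [w Gw <-] [w' Gw' <-]; exists (a *: w + w'); first exact: GL.
  rewrite /= linearD linearZ /=; congr (_, _).
  by rewrite mulrDr mulrCA.
have [|h [h1 hH]] := hahn_banach lH.
  move=> _ [w Gw <-] /=; rewrite normrM gtr0_norm ?invr_gt0// ler_pdivrMl//.
  by apply: le_trans (f1 _) _; have [] := Gc _ Gw.
have hG w : G w -> h w.2 = c^-1 * f w.1.
  by move=> Gw; exact: (hH (w.2, c^-1 * f w.1) (ex_intro2 _ _ w Gw erefl)).
have ci : c^-1 <= 1 by rewrite invf_le1.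
have [|psi [psi0 psiv]] := extend_functional h1 (e := e) (t := c^-1 * f t0).
  move=> j; rewrite -/(x_ j) -/(r_ j).
  have -> : c^-1 * f t0 - h (x_ j) = c^-1 * f (t0 - (z_ j).1) + h ((z_ j).2 - x_ j).
    by rewrite !linearB/= (hG _ (Gzs j)) /z_; ring.
  apply: le_trans (zr j); rewrite (le_trans (ler_normD _ _))// lerD//.
    rewrite normrM gtr0_norm ?invr_gt0//.
    apply: (@le_trans _ _ (1 * `|t0 - (z_ j).1|)).
      by apply: ler_pM => //; rewrite ltW// invr_gt0.
    by rewrite ler_wpM2r.
  exact: le_trans (h1 _) (zx j).
have e1 : `|c^-1 * f t0 - h z.2| = c^-1 * `|t0 - z.1|.
  rewrite (hG _ Gz) -mulrBr -linearB/= ft normrM normr_id gtr0_norm//.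
  by rewrite invr_gt0.
have e2 : `|h z.2 - h (z_ i).2| <= c * del.
  by rewrite -linearB (le_trans (h1 _))// distrC.
have e3 : `|h (z_ i).2 - h (x_ i)| <= del by rewrite -linearB (le_trans (h1 _)).
have e4 : `|val (z_ i).2 psi - val (x_ i) psi| <= del.
  by apply: le_trans (zx i); exact: (le_gen_norm ((z_ i).2 - x_ i) psi).
have e5 : `|val z.2 psi - val (z_ i).2 psi| <= c * del.
  by apply: le_trans zz2; rewrite [leRHS]distrC; exact: (le_gen_norm (z.2 - (z_ i).2) psi).
have e6 : `|c^-1 * f t0 - val z.2 psi| <= `|y0 - z.2|.
  by rewrite -psi0; exact: (le_gen_norm (y0 - z.2) psi).
have e7 := norm_add3 (V := R^o) e6 e5 e4.
have e8 : `|c^-1 * f t0 - h (x_ i)| <= `|y0 - z.2| + c * del + del.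
  by rewrite -(psiv (entry e i).1).
have e9 : `|h (x_ i) - h (z_ i).2| <= del by rewrite distrC.
have e10 : `|h (z_ i).2 - h z.2| <= c * del by rewrite distrC.
have := norm_add3 (V := R^o) e8 e9 e10; rewrite e1 => /(ler_wpM2l (ltW c0)).
rewrite mulrA divff ?gt_eqF// mul1r => /le_trans; apply.
rewrite -mulrA -mulrDr ler_wpM2l ?(ltW c0)//.
by move: `|y0 - z.2| => y; clear; lra.
Qed.

End approximate_extension.

Section gurarii_gen_space.
Variables (R : realType) (I : Type).
Local Notation E := (gen_space R I).

Section extension.
Variable T : normedModType R.
Hypothesis Tnets : finite_nets [set: T].

(** When [t0] is at distance [d > 0] from the domain, the net is taken so fine
that the additive errors of [extension_approx] are absorbed by [c' - c], and
on a ball so large that outside it the triangle inequality suffices. *)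
Lemma extension_gap (G : set (T * E)) (c c' d : R) (t0 : T) :
  linear_graph G -> 1 <= c -> c < c' -> (forall z, G z -> bilipschitz c z) ->
  0 < d -> (forall z, G z -> d <= `|t0 - z.1|) ->
  exists y0 : E, forall z, G z -> bilipschitz c' ((t0, y0) - z).
Proof.
move=> lG c1 cc' Gc d0 Gd; have c0 : 0 < c by lra.
have c'0 : 0 < c' by lra.
(* The sum of the two error coefficients of the approximation, scaled by c'. *)
pose K := c' * (c * (2 + 2 * c)) + c' * (3 + 2 * c).
have K1 : 0 < c' * (c * (2 + 2 * c)) by rewrite !mulr_gt0//; lra.
have K2 : 0 < c' * (3 + 2 * c) by rewrite mulr_gt0//; lra.
have K0 : 0 < K by rewrite addr_gt0.
pose del := (c' - c) * d / K.
have del0 : 0 < del by rewrite divr_gt0// mulr_gt0// subr_gt0.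
have delK : K * del = (c' - c) * d by rewrite mulrC divfK ?gt_eqF.
have del1 : c' * (c * (2 + 2 * c) * del) <= (c' - c) * d.
  by rewrite -delK [leRHS]mulrDl [leLHS]mulrA lerDl mulr_ge0 ?ltW.
have del2 : (3 + 2 * c) * del <= (c' - c) * d.
  rewrite -delK [leRHS]mulrDl.
  have : (3 + 2 * c) * del <= c' * (3 + 2 * c) * del.
    by rewrite ler_pM2r// ler_peMl; lra.
  by move/le_trans; apply; rewrite lerDr mulr_ge0 ?ltW.
(* Beyond these radii the upper, resp. the lower, estimate follows
   from the triangle inequality. *)
pose M1 := 2 * c' * `|t0| / (c' - c).
pose M2 := c * (c' * `|t0| + (1 + c * c') * `|t0| / (c' - c)).
have [zs [Gzs zsP]] := graph_nets (Num.max M1 M2) Tnets lG del0.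
have [y0 y0P] := extension_approx t0 lG c1 Gc del0 Gzs.
have near z : G z -> `|z.1| <= Num.max M1 M2 -> bilipschitz c' ((t0, y0) - z).
  move=> Gz zM; have [i il zi] := zsP _ Gz zM.
  have [h1 h2] := y0P _ _ Gz il zi; split => /=.
    exact: le_absorb_slack (Gd _ Gz) h2 del1.
  apply: (le_trans h1).
  have h3 : (c' - c) * d <= (c' - c) * `|t0 - z.1|.
    by rewrite ler_wpM2l ?subr_ge0 ?(ltW cc')//; exact: Gd.
  by have := le_trans del2 h3; rewrite mulrBl; lra.
exists y0 => z Gz.
have [|zM] := leP `|z.1| (Num.max M1 M2); first exact: near.
have y0t : `|y0| <= c' * `|t0|.
  have [|_ /=] := near 0 lG.1; last by rewrite !subr0.
  rewrite normr0 le_max; apply/orP; left.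
  by rewrite divr_ge0 ?subr_ge0 ?(ltW cc')// !mulr_ge0// ltW.
have [z1 z2] := Gc _ Gz.
move: zM; rewrite gt_max => /andP[m1 m2].
apply: (@bilipschitz_far R c c' `|t0| `|z.1| `|y0| `|z.2|) => //.
- by rewrite distrC lerB_dist.
- by rewrite [leRHS]addrC ler_normB.
- by rewrite [leRHS]addrC ler_normB.
- by rewrite distrC lerB_dist.
- exact: ltW.
- exact: ltW.
Qed.

Lemma extension_step (G : set (T * E)) (c c' : R) (t0 : T) :
  linear_graph G -> 1 <= c -> c < c' -> (forall z, G z -> bilipschitz c z) ->
  exists G' : set (T * E), [/\ linear_graph G', G `<=` G',
    exists y0, G' (t0, y0) & forall z, G' z -> bilipschitz c' z].
Proof.
move=> lG c1 cc' Gc.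
suff [y0 y0P] : exists y0 : E, forall z, G z -> bilipschitz c' ((t0, y0) - z).
  exists (adjoin G (t0, y0)); split; [exact: adjoin_linear|exact: sub_adjoin| |].
    by exists y0; exact: mem_adjoin.
  apply: adjoin_homogeneous => //; first by move=> a z; exact: bilipschitzZ.
    by move=> z /Gc; apply: bilipschitz_le; exact: ltW.
  move=> z Gz; rewrite -[z]opprK; apply: y0P.
  by rewrite -scaleN1r; exact: linear_graphZ.
have [[d d0 Gd]|nd] := pselect (exists2 d : R, 0 < d & forall z, G z -> d <= `|t0 - z.1|).
  exact: (extension_gap lG c1 cc' Gc d0 Gd).
have [||y0 y0P] := extension_closure (t0 := t0) lG _ Gc; first by lra.
  move=> d d0; apply: contrapT => nz; apply: nd; exists d => // z Gz.
  by rewrite leNgt; apply/negP => zd; apply: nz; exists z.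
by exists y0 => z /y0P; apply: bilipschitz_le; exact: ltW.
Qed.

(** Each vector uses up half of the remaining room between [c] and [c']. *)
Lemma extension_seq (bs : seq T) (G : set (T * E)) (c c' : R) :
  linear_graph G -> 1 <= c -> c < c' -> (forall z, G z -> bilipschitz c z) ->
  exists G' : set (T * E), [/\ linear_graph G', G `<=` G',
    forall b, b \in bs -> exists y, G' (b, y) & forall z, G' z -> bilipschitz c' z].
Proof.
elim: bs G c => [|b bs IH] G c lG c1 cc' Gc.
  by exists G; split => // z /Gc; apply: bilipschitz_le; exact: ltW.
pose k := (c + c') / 2.
have ck : c < k by rewrite /k; lra.
have [G1 [lG1 GG1 [y0 y0P] G1k]] := extension_step b lG c1 ck Gc.
have [||G' [lG' G1G' bsP G'c]] := IH G1 k lG1 _ _ G1k; [lra|rewrite /k; lra|].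
exists G'; split => //; first exact: subset_trans G1G'.
move=> x; rewrite inE => /orP[/eqP->|/bsP//].
by exists y0; exact: G1G'.
Qed.

End extension.

Theorem gurarii_gen_space : gurarii E.
Proof.
move=> T P S f e [n [b bP]] fiso e0.
have Tnets : finite_nets [set: T].
  move=> M del d0.
  have [l lP] := finite_nets_span [seq b i | i <- index_enum 'I_n] M d0.
  exists l => x _ xM; apply: lP => //.
  by have [c ->] := bP x; exact: mem_span_set.
pose G : set (T * E) := [set (val s, f s) | s in [set: S]].
have lG : linear_graph G.
  split; first by exists 0 => //; rewrite !linear0.
  move=> a _ _ [s _ <-] [s' _ <-]; exists (a *: s + s') => //.
  by rewrite !linearD !linearZ.
have Gc z : G z -> bilipschitz 1 z.
  by move=> [s _ <-]; split => /=; rewrite mul1r fiso.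
have [|G' [lG' GG' bsP G'e]] := extension_seq Tnets [seq b i | i <- index_enum 'I_n]
  (c' := 1 + e) lG (lexx 1) _ Gc; first by rewrite ltrDl.
have [||g gP] := graph_fun lG'.
- move=> y /G'e[_ /=]; rewrite normr0 mulr0 normr_le0 => /eqP //.
- move=> x; have [c ->] := bP x.
  elim: (index_enum 'I_n) (bsP) => [|i s IH] sP.
    by exists 0; rewrite big_nil; case: lG'.
  have [|y yP] := IH; first by move=> t ts; apply: sP; rewrite inE ts orbT.
  have [|z zP] := sP (b i); first by rewrite inE eqxx.
  by exists (c i *: z + y); rewrite big_cons; have [_ /(_ (c i) _ _ zP yP)] := lG'.
exists g; split; last first.
  by move=> s; apply/esym/gP/GG'; exists s.
move=> x _; have [/= h1 h2] := G'e _ ((gP x (g x)).2 erefl).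
by rewrite h2 andbT mulrC ler_pdivrMr 1?mulrC// addr_gt0.
Qed.

End gurarii_gen_space.

(** * Countable ordinals and countability of the generators *)

Section ordinals.

Lemma countable_strict_ub (A : set omega1) : countable A ->
  exists b, forall a, A a -> (a < b)%O.
Proof.
move=> cA; apply: contrapT => nub; apply: omega1_uncountable.
have -> : [set: omega1] = \bigcup_(a in A) [set b | (b <= a)%O].
  apply/seteqP; split => // b _.
  apply: contrapT => nb; apply: nub; exists b => a Aa.
  by rewrite ltNge; apply/negP => ba; apply: nb; exists a.
by apply: bigcup_countable => // a _; exact: omega1_countable_seg.
Qed.

Lemma finite_strict_ub (Q : set omega1) : Q !=set0 ->
  (forall a, Q a -> exists2 b, Q b & (a < b)%O) ->
  forall s : seq omega1, (forall i, i \in s -> Q i) ->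
  exists2 b, Q b & forall i, i \in s -> (i < b)%O.
Proof.
move=> [q Qq] Qsucc; elim=> [|i s IH] sQ; first by exists q.
have [j js|b Qb bs] := IH; first by apply: sQ; rewrite inE js orbT.
have [b' Qb' bb'] : exists2 b', Q b' & (Order.max i b < b')%O.
  by apply: Qsucc; rewrite /Order.max; case: ifP => // _; apply: sQ; rewrite inE eqxx.
exists b' => // j; rewrite inE => /orP[/eqP->|/bs jb].
  by apply: le_lt_trans bb'; rewrite le_max lexx.
by apply: lt_trans jb _; apply: le_lt_trans bb'; rewrite le_max lexx orbT.
Qed.

Lemma omega1_lt_wf : well_founded (fun a b : omega1 => (a < b)%O).
Proof.
move=> a; apply: contrapT => na.
have [|b nb bmin] := @omega1_min [set a | ~ Acc (fun a b : omega1 => (a < b)%O) a].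
  by exists a.
apply: nb; constructor => c cb; apply: contrapT => /bmin; rewrite leNgt cb.
by [].
Qed.

Lemma omega1_nonempty : [set: omega1] !=set0.
Proof.
apply/set0P/eqP => o0; apply: omega1_uncountable.
by rewrite o0; exact: countable0.
Qed.

(** By transfinite recursion, [F a] is a strictly increasing sequence lying
above all the values [F b n] with [b < a]; so [F] is strictly increasing for
the lexicographic order. *)
Lemma omega1_nat_inj : exists F : omega1 * nat -> omega1, injective F.
Proof.
have [a0 _] := omega1_nonempty.
have /choice[ub ubP] (A : set omega1) : exists b : omega1, countable A -> forall a, A a -> (a < b)%O.
  have [/countable_strict_ub[b bA]|ncA] := pselect (countable A); first by exists b.
  by exists a0.
pose step (a : omega1) (rec : forall b, (b < a)%O -> nat -> omega1) : nat -> omega1 :=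
  fun n => iter n (fun b => ub [set b])
    (ub [set c | exists b (ba : (b < a)%O) m, c = rec b ba m]).
pose F := Fix omega1_lt_wf (fun=> nat -> omega1) step.
have FE a : F a = step a (fun b _ => F b).
  rewrite /F Fix_eq// => x f g fg; suff -> : f = g by [].
  by do 2 (apply: functional_extensionality_dep => ?).
have Flt a b n : (a < b)%O -> (F a n < F b 0%N)%O.
  move=> ab; rewrite [F b]FE /=; apply: ubP; last by exists a, ab, n.
  apply: (@sub_countable _ _ _ (\bigcup_(c in [set c | (c <= b)%O]) (F c @` setT))).
    by apply: subset_card_le => _ [c [cb [m ->]]]; exists c; [exact: ltW|exists m].
  apply: bigcup_countable; first exact: omega1_countable_seg.
  by move=> c _; apply: (sub_countable (card_image_le _ _)); exact: countableP.
have Fhomo a : {homo F a : n m / (n < m)%N >-> (n < m)%O}.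
  apply: (homo_ltn lt_trans) => n.
  by rewrite FE /step iterS; apply: ubP => //; exact: countable1.
have Fle a n : (F a 0%N <= F a n)%O.
  by case: n => // n; apply: ltW; exact: Fhomo.
exists (fun p => F p.1 p.2) => -[a n] [b m] /= Fab.
have ab : a = b.
  case: (ltgtP a b) => // [ab|ba].
    by have := lt_le_trans (Flt a b n ab) (Fle b m); rewrite Fab ltxx.
  by have := lt_le_trans (Flt b a m ba) (Fle a n); rewrite Fab ltxx.
subst b; congr (_, _); case: (ltngtP n m) => // nm.
  by have := Fhomo a _ _ nm; rewrite Fab ltxx.
by have := Fhomo a _ _ nm; rewrite Fab ltxx.
Qed.

End ordinals.

Section countability.

Lemma comb_map_inj G H (f : G -> H) : injective f -> injective (comb_map f).
Proof. by move=> finj; apply: inj_map => -[q g] [q' g'] [-> /finj ->]. Qed.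

Lemma ext_map_inj G H (f : G -> H) : injective f -> injective (ext_map f).
Proof.
move=> finj [g|[B l]] [g'|[B' l']] //= [].
  by move=> /finj ->.
move=> -> ll'; congr (inr (_, _)); apply: inj_map ll' => -[v q] [v' q'] [].
by move=> /(comb_map_inj finj) -> ->.
Qed.

(** Generators over [nat] are finite trees with natural and rational labels.
*)
Lemma gen_nat_inj n : exists f : gen n nat -> nat, injective f.
Proof.
elim: n => [|n [f finj]]; first by exists id.
exists (fun x => pickle (ext_map f x : (nat + nat * seq (seq (rat * nat) * rat))%type)).
by move=> x y /(pcan_inj pickleK) /(ext_map_inj finj).
Qed.

Lemma countable_comb_gen n : countable [set: comb (gen n nat)].
Proof.
have [f finj] := gen_nat_inj n.
apply/countable_injP; exists (fun v => pickle (comb_map f v : seq (rat * nat))).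
by move=> v w _ _ /(pcan_inj pickleK) /(comb_map_inj finj).
Qed.

(** The range of [r] is enumerated by [nat], so that every combination in the
image of [r] comes from a combination of generators over [nat]. *)
Lemma countable_gev_image (R : realType) I (i0 : I) (r : I -> I) :
  countable (range r) ->
  countable [set x | exists n (v : comb (gen n I)), x = gev R (comb_map (gen_map r) v)].
Proof.
move=> /countable_injP[f finj].
have /choice[k kP] (m : nat) : exists i, forall a, range r a -> f a = m -> i = a.
  have [[a ra am]|na] := pselect (exists2 a, range r a & f a = m).
    by exists a => b rb bm; apply: finj; rewrite ?am ?bm//; exact/mem_set.
  by exists i0 => a ra am; exfalso; apply: na; exists a.
have -> : r = k \o (f \o r).
  by apply/funext => i /=; apply/esym/kP => //; exists i.
apply: (@sub_countable _ _ _ (\bigcup_(n in [set: nat])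
    ((fun w : comb (gen n nat) => gev R (comb_map (gen_map k) w)) @` setT))).
  apply: subset_card_le => _ [n [v ->]]; exists n => //.
  by exists (comb_map (gen_map (f \o r)) v) => //; rewrite comb_gen_map_comp.
apply: bigcup_countable => // n _.
exact: sub_countable (card_image_le _ _) (countable_comb_gen n).
Qed.

End countability.

(** * The projectional resolution and the density *)

Section norm_topology.
Variables (R : realType) (V : normedModType R).

Lemma closure_normP (A : set V) x :
  closure A x <-> forall eps : R, 0 < eps -> exists2 y, A y & `|x - y| <= eps.
Proof.
split=> [Ax eps e0|h B /nbhs_ballP[eps /= e0 xB]].
  have [y [Ay]] := Ax _ (nbhsx_ballx x eps e0).
  by rewrite -ball_normE /= => /ltW xy; exists y.
have e20 : 0 < eps / 2 by rewrite divr_gt0.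
have [y Ay xy] := h _ e20.
exists y; split => //; apply: xB; rewrite -ball_normE /=.
by rewrite (le_lt_trans xy)//; lra.
Qed.

Lemma denseP (A : set V) :
  dense A <-> forall x (eps : R), 0 < eps -> exists2 y, A y & `|x - y| <= eps.
Proof.
split=> [dA x eps e0|h O [x Ox] oO].
  have [|y [xy Ay]] := dA _ _ (ball_open x eps).
    by exists x; exact: ballxx.
  by exists y => //; move: xy; rewrite -ball_normE /= => /ltW.
have /closure_normP xA : forall eps : R, 0 < eps -> exists2 y, A y & `|x - y| <= eps.
  exact: h.
have [y [Ay Oy]] := xA O (open_nbhs_nbhs (conj oO Ox)).
by exists y.
Qed.

Lemma contraction_fixed_closed (f : {linear V -> V}) x :
  (forall y, `|f y| <= `|y|) ->
  (forall eps : R, 0 < eps -> exists2 y, f y = y & `|x - y| <= eps) -> f x = x.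
Proof.
move=> f1 h; apply/eqP; rewrite -subr_eq0 -normr_le0.
apply/ler_addgt0Pr => eps e0; rewrite add0r.
have e20 : 0 < eps / 2 by rewrite divr_gt0.
have [y fy xy] := h _ e20.
have -> : f x - x = f (x - y) - (x - y) by rewrite linearB fy opprB addrA subrK.
rewrite (le_trans (ler_normB _ _))// [leRHS]splitr lerD//.
exact: le_trans (f1 _) xy.
Qed.

End norm_topology.

Section resolution.
Variable R : realType.
Local Notation I := (option omega1).
Local Notation E := (gen_space R I).

(** [None] is an additional base generator: it absorbs the ordinals from [a]
on, and it keeps the smallest projection nonzero. *)
Definition truncate (a : omega1) (o : I) : I :=
  if o is Some i then if (i < a)%O then Some i else None else None.

Definition proj (a : omega1) : {linear E -> E} := gen_space_map R (truncate a).

Lemma truncate_comp a b : truncate a \o truncate b = truncate (Order.min a b).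
Proof.
apply/funext => -[i|] //=; rewrite lt_min.
by case: ifP => //= ib; [rewrite andbT|rewrite andbF].
Qed.

Lemma proj_comp a b x : proj a (proj b x) = proj (Order.min a b) x.
Proof. by rewrite /proj gen_space_map_comp truncate_comp. Qed.

Lemma proj_id a x : proj a (proj a x) = proj a x.
Proof. by rewrite proj_comp minxx. Qed.

Lemma proj_contraction a x : `|proj a x| <= `|x|.
Proof. exact: gen_space_map_contraction. Qed.

Lemma proj_fixed_le a b x : (a <= b)%O -> proj a x = x -> proj b x = x.
Proof. by move=> ab ax; rewrite -ax proj_comp min_r. Qed.

Lemma range_projP a x : range (proj a) x <-> proj a x = x.
Proof.
split=> [[y _ <-]|ax]; first exact: proj_id.
by exists x.
Qed.

Lemma family_of_base (phi : I -> R) : (forall i, `|phi i| <= 1) ->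
  exists psi : functional_family R I, forall i, val (gen_vec R (n := 0) i) psi = phi i.
Proof.
move=> phi1; have [psi psiE] := @dual_ball_extends R I 0%N phi phi1.
by exists psi => i; rewrite gen_vecE psiE.
Qed.

Lemma proj_norm a : operator_norm (proj a) = 1%E.
Proof.
pose u : E := gen_vec R (n := 0) (I := I) None.
have u1 : `|u| <= 1.
  apply: gen_norm_le => psi; rewrite gen_vecE.
  by have [/(_ None)] := svalP psi 0%N.
have fu : proj a u = u by rewrite /proj gen_space_map_gev.
apply/eqP; rewrite eq_le; apply/andP; split.
  apply: ge_ereal_sup => _ [x x1 <-]; rewrite lee_fin.
  exact: le_trans (proj_contraction _ _) x1.
apply: ereal_sup_ubound; exists u => //; rewrite fu; congr EFin.
apply/eqP; rewrite eq_le u1 /=.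
have [psi psiE] := family_of_base (fun=> ltac:(by rewrite normr1) : `|(1 : R)| <= 1).
by have := le_gen_norm u psi; rewrite psiE normr1.
Qed.

Lemma countable_range_truncate a : countable (range (truncate a)).
Proof.
apply: (@sub_countable _ _ _ (None |` (Some @` [set i | (i <= a)%O]))).
  apply: subset_card_le => _ [[i|] _ <-] /=; last by left.
  by case: ifP => ia; [right; exists i => //; exact: ltW|left].
rewrite -bigcup2E; apply: bigcup_countable => // -[|[|n]] _ //=.
exact: sub_countable (card_image_le _ _) (omega1_countable_seg a).
Qed.

Definition level_dense (a : omega1) : set E :=
  [set x | exists n (v : comb (gen n I)), x = gev R (comb_map (gen_map (truncate a)) v)].

Lemma countable_level_dense a : countable (level_dense a).
Proof. exact (countable_gev_image R None (countable_range_truncate a)). Qed.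

Lemma proj_gev a n (v : comb (gen n I)) :
  proj a (gev R v) = gev R (comb_map (gen_map (truncate a)) v).
Proof. exact: gen_space_map_gev. Qed.

Lemma proj_separable a : separable_set (range (proj a)).
Proof.
exists (level_dense a); split; first exact: countable_level_dense.
  by move=> _ [n [v ->]]; exists (gev R v) => //; exact: proj_gev.
move=> x /range_projP ax; apply/closure_normP => eps e0.
have [n [v xv]] := gev_dense x e0.
exists (proj a (gev R v)); first by exists n, v; rewrite proj_gev.
by rewrite -ax -linearB (le_trans (proj_contraction _ _)).
Qed.

(** The combination [v], once its base generators are renamed by [r], mentions
finitely many ordinals, all in [Q], hence all below some [a] in [Q]. *)
Lemma gev_absorbed (Q : set omega1) (r : I -> I) n (v : comb (gen n I)) :
  Q !=set0 -> (forall a, Q a -> exists2 b, Q b & (a < b)%O) ->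
  (forall o i, r o = Some i -> Q i) ->
  exists2 a, Q a & proj a (gen_space_map R r (gev R v)) = gen_space_map R r (gev R v).
Proof.
move=> Q0 Qsucc rQ.
have [s sP] := comb_finite_support (@gen_finite_support _ I n) v.
have [|a Qa aP] := @finite_strict_ub Q Q0 Qsucc (pmap r s).
  move=> i; rewrite mem_pmap => /mapP[x _ /esym]; exact: rQ.
exists a => //; rewrite !gen_space_map_gev comb_gen_map_comp; congr gev.
apply: sP => o os /=; case ro : (r o) => [i|] //=.
by rewrite aP// mem_pmap -ro map_f.
Qed.

Lemma proj_limit d : limit_ordinal d ->
  range (proj d) = closure (\bigcup_(a in [set a | (a < d)%O]) range (proj a)).
Proof.
move=> [[a0 a0d] dlim]; apply/seteqP; split=> x.
  move=> /range_projP dx; apply/closure_normP => eps e0.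
  have [n [v xv]] := gev_dense x e0.
  have [||o i|a ad av] := @gev_absorbed [set a | (a < d)%O] (truncate d) n v.
  - by exists a0.
  - by move=> a /dlim[b /andP[ab bd]]; exists b.
  - by case: o => [j|//] /=; case: ifP => // jd [<-].
  exists (proj d (gev R v)); first by exists a => //; apply/range_projP.
  by rewrite -dx -linearB (le_trans (proj_contraction _ _)).
move=> /closure_normP h; apply/range_projP.
apply: contraction_fixed_closed => [y|eps /h[y [a /= ad /range_projP ay] xy]].
  exact: proj_contraction.
by exists y => //; apply: proj_fixed_le ay; exact: ltW.
Qed.

Lemma omega1_succ (a : omega1) : exists2 b, setT b & (a < b)%O.
Proof.
by have [b bP] := countable_strict_ub (countable1 a); exists b => //; exact: bP.
Qed.

Lemma gev_fixed n (v : comb (gen n I)) : exists a, proj a (gev R v) = gev R v.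
Proof.
have [||//|a _] := @gev_absorbed setT id n v.
- exact: omega1_nonempty.
- by move=> a _; exact: omega1_succ.
by rewrite gen_space_map_gev comb_gen_map_id; exists a.
Qed.

(** A vector is the limit of countably many combinations, each fixed by some
projection, and countably many countable ordinals have a strict upper bound.
*)
Lemma proj_cover : \bigcup_(a in [set: omega1]) range (proj a) = [set: E].
Proof.
apply/seteqP; split => // x _.
have /choice[al alP] (n : nat) : exists a, exists2 y, proj a y = y & `|x - y| <= n.+1%:R^-1.
  have [|m [v xv]] := gev_dense x (eps := n.+1%:R^-1); first by rewrite invr_gt0.
  by have [a av] := gev_fixed v; exists a, (gev R v).
have [|b bP] := @countable_strict_ub (range al).
  exact: sub_countable (card_image_le _ _) (countableP _).
exists b => //; apply/range_projP; apply: contraction_fixed_closed.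
  by move=> y; exact: proj_contraction.
move=> eps e0; pose n := Num.truncn eps^-1.
have [y yf xy] := alP n; exists y.
  by apply: proj_fixed_le yf; apply: ltW; apply: bP; exists n.
apply: (le_trans xy); rewrite -[leRHS]invrK lef_pV2 ?posrE ?invr_gt0//.
have /truncn_itv/andP[_ /ltW //] : 0 <= eps^-1 by rewrite invr_ge0 ltW.
Qed.

Theorem proj_resolution : projectional_resolution proj.
Proof.
split.
- exact: proj_id.
- exact: proj_norm.
- exact: proj_separable.
- by move=> a b ab x /range_projP ax; apply/range_projP; apply: proj_fixed_le ax; exact: ltW.
- exact: proj_limit.
- exact: proj_cover.
- exact: proj_comp.
Qed.

(** Level 0 of the dual ball contains all functions with values between -1 and
1, in particular one that separates [i] from [j]. *)
Lemma base_separated (i j : omega1) : i != j ->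
  2 <= `|gen_vec R (n := 0) (Some i : I) - gen_vec R (n := 0) (Some j : I)|.
Proof.
move=> ij.
have [|psi psiE] := @family_of_base (fun o => if o == Some i then 1 else -1).
  by move=> o; case: ifP => _; rewrite ?normrN normr1.
have := le_gen_norm (gen_vec R (n := 0) (Some i : I) - gen_vec R (n := 0) (Some j : I)) psi.
rewrite (_ : val (_ - _) psi = val (gen_vec R (n := 0) (Some i : I)) psi -
  val (gen_vec R (n := 0) (Some j : I)) psi)// !psiE eqxx.
rewrite ifF; last by apply/eqP => -[ji]; move: ij; rewrite ji eqxx.
by rewrite opprK ger0_norm.
Qed.

Lemma card_le_of_inj (T U : Type) (A : set T) (B : set U) (f : T -> U) :
  (forall x, A x -> B (f x)) -> (forall x y, A x -> A y -> f x = f y -> x = y) ->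
  (A #<= B)%card.
Proof.
move=> fAB finj; have : (f @` A #= A)%card.
  by apply: inj_card_eq => x y /set_mem Ax /set_mem Ay; exact: finj.
rewrite card_eq_le => /andP[_ h].
apply: card_le_trans h _; apply: subset_card_le => _ [x Ax <-]; exact: fAB.
Qed.

(** A dense set has an element within 1/2 of each base generator, which bounds
its size from below. The rational combinations inject in [omega1 * nat],
through a projection fixing the combination and an enumeration of the
combinations it fixes. *)
Theorem density_gen_space : density_eq E [set: omega1].
Proof.
have lower (D : set E) : dense D -> ([set: omega1] #<= D)%card.
  move=> /denseP dD.
  have e2 : 0 < (1 / 2 : R) by rewrite divr_gt0.
  have /choice[f fP] (i : omega1) : exists y, D y /\ `|gen_vec R (n := 0) (Some i : I) - y| <= 1 / 2.
    by have [y Dy iy] := dD (gen_vec R (n := 0) (Some i : I)) _ e2; exists y.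
  apply: (@card_le_of_inj _ _ _ _ f) => [i _|i j _ _ fij]; first by have [] := fP i.
  apply/eqP; apply: contraT => /base_separated.
  have [_ fi] := fP i; have [_ fj] := fP j; rewrite -fij distrC in fj.
  rewrite -(subrKA (f i)) => h.
  have := le_trans h (ler_normD _ _) => {}h.
  by have := le_trans h (lerD fi fj); lra.
split; last exact: lower.
pose D : set E := [set x | exists n (v : comb (gen n I)), x = gev R v].
have dD : dense D.
  apply/denseP => x eps e0; have [n [v xv]] := gev_dense x e0.
  by exists (gev R v) => //; exists n, v.
exists D => //; rewrite card_eq_le lower// andbT.
have /choice[al alP] (x : E) : exists a, D x -> level_dense a x.
  have [[n [v xv]]|nD] := pselect (D x); last first.
    by have [a _] := omega1_nonempty; exists a.
  have [a av] := gev_fixed v; exists a => _.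
  by rewrite xv -av proj_gev; exists n, v.
have /choice[c cP] a := countable_injP _ (countable_level_dense a).
have [F Finj] := omega1_nat_inj.
apply: (@card_le_of_inj _ _ _ _ (fun x => F (al x, c (al x) x))) => // x y Dx Dy.
move=> /Finj[alE]; rewrite alE; apply: (cP (al y)); apply/mem_set.
  by rewrite -alE; exact: alP.
exact: alP.
Qed.

End resolution.

Theorem theorem3p7 (R : realType) :
  exists E : completeNormedModType R,
    [/\ gurarii E,
        density_eq E [set: omega1]%classic &
        exists P : omega1 -> {linear E -> E}, projectional_resolution P].
Proof.
exists (gen_space R (option omega1)); split.
- exact: gurarii_gen_space.
- exact: density_gen_space.
- by exists (@proj R); exact: proj_resolution.
Qed.
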